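(* Let $a>0$, $\nu>0$, $\beta\ge0$ be constants, let $S^2(a^2)=\{(x_1,x_2,x_3)\in\mathbb{R}^3: x_1^2+x_2^2+x_3^2=\frac1{a^2}\}$, let $O\in S^2(a^2)$ be a selected base point, and let $(r,\theta)$ be the normal polar coordinate system on $S^2(a^2)$ about $O$. Let $\delta\in(0,\frac{\pi}{a})$, and let $K$ be a compact subset of $\{p\in S^2(a^2): d(p,O)\le\delta\}$ (an obstacle) such that, for some $\tau\in(0,2\pi)$, the circular arc $C_{\delta,\tau}=\{p\in S^2(a^2): d(p,O)=\delta,\ 0<\theta(p)<\tau\}$ is a smooth boundary portion of $\partial K$, i.e. $C_{\delta,\tau}\subset\partial K$. Then for any prescribed $\alpha_1>0$, $\alpha_2>0$, there exists a unique smooth function $Y:[\delta,\frac{\pi}{a})\to\mathbb{R}$ satisfying $Y(\delta)=0$, $Y'(\delta)=\alpha_1$, $Y''(\delta)=-\alpha_2$ such that the associated parallel laminar flow $$u=-Y(r)\,\frac{a}{\sin(ar)}\,\frac{\partial}{\partial\theta}$$ solves the stationary Navier-Stokes equation $$\nu\big((-\triangle)u^*-2\,\mathrm{Ric}(u^* )\big)+\beta\cos(ar)\,{*u^*}+[\overline{\nabla}_u u]^*+dP=0,\qquad d^*u^*=0$$ (for some smooth pressure $P$) in the simply-connected exterior region $$\Omega_{\delta,\tau}=\{p\in S^2(a^2): \delta<d(p,O)<\tfrac{\pi}{a},\ 0<\theta(p)<\tau\},$$ which shares the circular-arc boundary portion $C_{\delta,\tau}$ with $\partial K$. Moreover, this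 unique function $Y$ is real-analytic on $[\delta,\frac{\pi}{a})$.
   Context: $S^2(a^2)$ carries the Riemannian metric $g$ induced from $\mathbb{R}^3$ (constant sectional curvature $a^2$); $d(\cdot,\cdot)$ is its geodesic distance. The exponential map $\exp_O:\{v\in T_OS^2(a^2):\|v\|<\frac{\pi}{a}\}\to S^2(a^2)\setminus\{-O\}$ is a diffeomorphism; identifying $T_OS^2(a^2)$ with $\mathbb{R}^2$ by a positively oriented orthonormal basis, the normal polar coordinate system is $(r,\theta)=(\overline r,\overline\theta)\circ\exp_O^{-1}$, where $(\overline r,\overline\theta)$ are the standard polar coordinates on $\mathbb{R}^2\setminus\{(x_1,0):x_1\ge0\}$ with values in $(0,\infty)\times(0,2\pi)$. So $r(p)=d(p,O)\in(0,\frac{\pi}{a})$, $\theta\in(0,2\pi)$, and $\frac{\partial}{\partial r},\frac{\partial}{\partial\theta}$ are the induced coordinate vector fields; the metric is $g=dr^2+\frac{\sin^2(ar)}{a^2}d\theta^2$, and $(dr,d\theta)$ is positively oriented. For a smooth vector field $X$, $X^*=g(X,\cdot)$ is the associated $1$-form. $\overline\nabla$ is the Levi-Civita connection. $*$ is the Hodge star, with $*dr=\frac{\sin(ar)}{a}d\theta$, $*d\theta=-\frac{a}{\sin(ar)}dr$, and $*\mathrm{Vol}=1$ where $\mathrm{Vol}=\frac{\sin(ar)}{a}dr\wedge d\theta$. $d^*=-*d*$ is the formal adjoint of the exterior derivative $d$ (on $1$-forms $d^*u^*=-\mathrm{div}\,u$), and $(-\triangle)=dd^*+d^*d$ is the Hodge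 Laplacian on $1$-forms. $\mathrm{Ric}$ is the Ricci tensor acting on $1$-forms; on $S^2(a^2)$, $\mathrm{Ric}(u^* )=a^2u^*$. The constant $\nu>0$ is the viscosity, $\beta\ge0$ is the constant rotation speed of the sphere. A vector field $u$ ''solves'' the equation in a region if there is a smooth pressure function $P$ on that region such that the system holds there. *)

(* Defs.v *)
From Stdlib Require Export Reals List Lra.
From Coquelicot Require Export Coquelicot.
Open Scope R_scope.

(** * The round sphere in R^3 *)

Definition R3 : Type := (R * R * R)%type.

Definition c1 (p : R3) : R := fst (fst p).
Definition c2 (p : R3) : R := snd (fst p).
Definition c3 (p : R3) : R := snd p.

Definition add3 (p q : R3) : R3 := (c1 p + c1 q, c2 p + c2 q, c3 p + c3 q).
Definition scal3 (k : R) (p : R3) : R3 := (k * c1 p, k * c2 p, k * c3 p).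
Definition dot3 (p q : R3) : R := c1 p * c1 q + c2 p * c2 q + c3 p * c3 q.
Definition norm3 (p : R3) : R := sqrt (dot3 p p).
Definition det3 (p q s : R3) : R :=
  c1 p * (c2 q * c3 s - c3 q * c2 s)
  - c2 p * (c1 q * c3 s - c3 q * c1 s)
  + c3 p * (c1 q * c2 s - c2 q * c1 s).

Definition sphere (a : R) (p : R3) : Prop := dot3 p p = 1 / a ^ 2.

Definition is_derive3 (gam : R -> R3) (t : R) (l : R3) : Prop :=
  is_derive (fun s => c1 (gam s)) t (c1 l) /\
  is_derive (fun s => c2 (gam s)) t (c2 l) /\
  is_derive (fun s => c3 (gam s)) t (c3 l).

Lemma is_derive3_ext (f g : R -> R3) (t : R) (l : R3) :
  (forall s, f s = g s) -> is_derive3 f t l -> is_derive3 g t l.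
Proof.
intros E (h1 & h2 & h3); split; [|split];
  [revert h1|revert h2|revert h3]; apply is_derive_ext; intros s; now rewrite E.
Qed.

(** C^1 curves are total functions of which only the part over [0,1] matters;
    two-sided derivatives at 0 and 1 lose nothing, since a C^1 curve on [0,1]
    extends to a C^1 curve of R^3 on a larger interval. *)
Definition C1_curve_on_sphere (a : R) (p q : R3) (gam dgam : R -> R3) : Prop :=
  gam 0 = p /\ gam 1 = q /\
  forall t, 0 <= t <= 1 ->
    sphere a (gam t) /\
    is_derive3 gam t (dgam t) /\
    continuous dgam t.

Definition sphere_dist (a : R) (p q : R3) : R :=
  real (Glb_Rbar (fun l => exists gam dgam : R -> R3,
    C1_curve_on_sphere a p q gam dgam /\
    l = RInt (fun t => norm3 (dgam t)) 0 1)).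

(** [(e1, e2)] is a positively oriented orthonormal basis of the tangent plane
    at [O], the sphere being oriented by its outward normal. *)
Definition oriented_tangent_basis (O e1 e2 : R3) : Prop :=
  dot3 O e1 = 0 /\ dot3 O e2 = 0 /\
  dot3 e1 e1 = 1 /\ dot3 e2 e2 = 1 /\ dot3 e1 e2 = 0 /\
  0 < det3 O e1 e2.

(** The geodesics from [O] are the great circles; for [v = 0] the second
    summand vanishes whatever the value of [sin 0 / 0].  The lemma
    [sphere_exp_geodesic] below justifies the formula. *)
Definition sphere_exp (a : R) (O v : R3) : R3 :=
  add3 (scal3 (cos (a * norm3 v)) O)
       (scal3 (sin (a * norm3 v) / (a * norm3 v)) v).

Lemma norm3_scal3 (k : R) (v : R3) : norm3 (scal3 k v) = Rabs k * norm3 v.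
Proof.
unfold norm3, dot3, scal3, c1, c2, c3; simpl.
rewrite <- (sqrt_Rsqr_abs k), <- sqrt_mult_alt by apply Rle_0_sqr.
f_equal; unfold Rsqr; ring.
Qed.

Lemma sphere_exp_scal3 (a : R) (O v : R3) (t : R) : 0 < a -> 0 < norm3 v ->
  sphere_exp a O (scal3 t v) =
  add3 (scal3 (cos (a * norm3 v * t)) O)
       (scal3 (sin (a * norm3 v * t) / (a * norm3 v)) v).
Proof.
intros ha hv. unfold sphere_exp. rewrite norm3_scal3.
unfold add3, scal3, c1, c2, c3; simpl.
destruct (Req_dec t 0) as [->|ht].
{ replace (a * (Rabs 0 * norm3 v)) with 0 by (rewrite Rabs_R0; ring).
  replace (a * norm3 v * 0) with 0 by ring. rewrite sin_0, cos_0.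
  replace (0 / (a * norm3 v)) with 0 by (unfold Rdiv; ring).
  f_equal; [f_equal|]; ring. }
assert (E1 : cos (a * (Rabs t * norm3 v)) = cos (a * norm3 v * t)).
{ unfold Rabs; destruct (Rcase_abs t); [rewrite <- cos_neg|]; f_equal; ring. }
assert (E2 : sin (a * (Rabs t * norm3 v)) / (a * (Rabs t * norm3 v)) * t
             = sin (a * norm3 v * t) / (a * norm3 v)).
{ unfold Rabs; destruct (Rcase_abs t).
  - replace (a * (- t * norm3 v)) with (- (a * norm3 v * t)) by ring.
    rewrite sin_neg. field. lra.
  - replace (a * (t * norm3 v)) with (a * norm3 v * t) by ring. field. lra. }
rewrite E1, <- E2. f_equal; [f_equal|]; ring.
Qed.

(** [t |-> sphere_exp a O (t v)] is the geodesic of the sphere starting at [O]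
    with velocity [v]: its acceleration is normal to the sphere. *)
Lemma sphere_exp_geodesic (a : R) (O v : R3) :
  0 < a -> sphere a O -> dot3 O v = 0 -> 0 < norm3 v ->
  let gam := fun t => sphere_exp a O (scal3 t v) in
  exists dgam : R -> R3,
    gam 0 = O /\ dgam 0 = v /\
    forall t, sphere a (gam t) /\ is_derive3 gam t (dgam t) /\
      is_derive3 dgam t (scal3 (- (a * norm3 v) ^ 2) (gam t)).
Proof.
intros ha hO hv hn gam.
assert (E : forall t, gam t = _) by (intros t; exact (sphere_exp_scal3 a O v t ha hn)).
assert (N : dot3 v v = norm3 v * norm3 v).
{ unfold norm3. rewrite sqrt_sqrt; trivial. unfold dot3. nra. }
set (k := a * norm3 v) in *.
assert (hk : k <> 0) by (unfold k; nra).
exists (fun t => add3 (scal3 (- k * sin (k * t)) O) (scal3 (cos (k * t)) v)).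
split; [|split].
- rewrite E, Rmult_0_r, sin_0, cos_0. destruct O as [[? ?] ?].
  unfold add3, scal3, c1, c2, c3; simpl. f_equal; [f_equal|]; field; trivial.
- rewrite Rmult_0_r, sin_0, cos_0. destruct v as [[? ?] ?].
  unfold add3, scal3, c1, c2, c3; simpl. f_equal; [f_equal|]; ring.
- intros t. split; [|split].
  + rewrite E. unfold sphere in *.
    transitivity (cos (k * t) ^ 2 * dot3 O O + (sin (k * t) / k) ^ 2 * dot3 v v
                  + 2 * cos (k * t) * (sin (k * t) / k) * dot3 O v).
    { unfold dot3, add3, scal3, c1, c2, c3; simpl; ring. }
    assert (T := sin2_cos2 (k * t)). unfold Rsqr in T.
    replace (cos (k * t) ^ 2) with (1 - sin (k * t) * sin (k * t)) by lra.
    rewrite hO, hv, N. unfold k. field. lra.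
  + apply (is_derive3_ext (fun s =>
      add3 (scal3 (cos (k * s)) O) (scal3 (sin (k * s) / k) v))).
    { intros s; symmetry; apply E. }
    split; [|split]; unfold add3, scal3, c1, c2, c3; simpl; clearbody k;
      auto_derive; trivial; field; trivial.
  + rewrite E.
    split; [|split]; unfold add3, scal3, c1, c2, c3; simpl; clearbody k;
      auto_derive; trivial; field; trivial.
Qed.

Definition polar_chart (a : R) (O e1 e2 : R3) (r theta : R) : R3 :=
  sphere_exp a O (add3 (scal3 (r * cos theta) e1) (scal3 (r * sin theta) e2)).

Definition has_polar_coord (a : R) (O e1 e2 p : R3) (r theta : R) : Prop :=
  0 < r < PI / a /\ 0 < theta < 2 * PI /\ p = polar_chart a O e1 e2 r theta.

(** ** Point sets *)

Definition compact_set (K : R3 -> Prop) : Prop :=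
  forall (I : Type) (U : I -> R3 -> Prop),
    (forall i, open (U i)) ->
    (forall p, K p -> exists i, U i p) ->
    exists l : list I, forall p, K p -> exists i, In i l /\ U i p.

(** Boundary relative to the sphere. *)
Definition sphere_boundary (a : R) (K : R3 -> Prop) (p : R3) : Prop :=
  sphere a p /\
  forall eps : posreal,
    (exists q, ball p eps q /\ sphere a q /\ K q) /\
    (exists q, ball p eps q /\ sphere a q /\ ~ K q).

Definition arc (a : R) (O e1 e2 : R3) (delta tau : R) (p : R3) : Prop :=
  sphere a p /\ sphere_dist a p O = delta /\
  exists r theta, has_polar_coord a O e1 e2 p r theta /\ 0 < theta < tau.

Definition exterior_region (a : R) (O e1 e2 : R3) (delta tau : R) (p : R3) : Prop :=
  sphere a p /\ delta < sphere_dist a p O < PI / a /\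
  exists r theta, has_polar_coord a O e1 e2 p r theta /\ 0 < theta < tau.

(** As for curves above, paths and homotopies are total functions whose values
    outside [0,1] are irrelevant. *)
Definition path_in (D : R3 -> Prop) (p q : R3) (gam : R -> R3) : Prop :=
  gam 0 = p /\ gam 1 = q /\
  forall t, 0 <= t <= 1 -> D (gam t) /\ continuous gam t.

Definition simply_connected (D : R3 -> Prop) : Prop :=
  (exists p, D p) /\
  (forall p q, D p -> D q -> exists gam, path_in D p q gam) /\
  (forall p gam, path_in D p p gam ->
     exists H : R * R -> R3,
       (forall s t, 0 <= s <= 1 -> 0 <= t <= 1 ->
          D (H (s, t)) /\ continuous H (s, t)) /\
       (forall t, 0 <= t <= 1 -> H (0, t) = gam t /\ H (1, t) = p) /\
       (forall s, 0 <= s <= 1 -> H (s, 0) = p /\ H (s, 1) = p)).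

(** * Riemannian calculus in an oriented two-dimensional chart

    Tensor fields are given by their components in the coordinate frame; the
    coordinates are indexed by [Cr] and [Ct], in this (positive) order.  A
    2-form is given by its coefficient on dr /\ dtheta. *)

Inductive coord := Cr | Ct.

Definition scalar := R -> R -> R.
Definition vfield := coord -> scalar.
Definition oneform := coord -> scalar.
Definition twoform := scalar.
Definition metric := coord -> coord -> scalar.

Definition sumc (f : coord -> R) : R := f Cr + f Ct.

Definition partial (i : coord) (f : scalar) : scalar :=
  fun r t => match i with
             | Cr => Derive (fun x => f x t) r
             | Ct => Derive (fun y => f r y) t
             end.

Definition eps2 (i j : coord) : R :=
  match i, j with
  | Cr, Ct => 1
  | Ct, Cr => -1
  | _, _ => 0
  end.

Definition detg (g : metric) : scalar :=
  fun r t => g Cr Cr r t * g Ct Ct r t - g Cr Ct r t * g Ct Cr r t.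

Definition ginv (g : metric) : metric :=
  fun i j r t =>
    match i, j with
    | Cr, Cr => g Ct Ct r t / detg g r t
    | Ct, Ct => g Cr Cr r t / detg g r t
    | _, _ => - g i j r t / detg g r t
    end.

(** Gamma^k_{ij} of the Levi-Civita connection. *)
Definition christoffel (g : metric) (k i j : coord) : scalar :=
  fun r t => / 2 * sumc (fun l => ginv g k l r t *
    (partial i (g j l) r t + partial j (g i l) r t - partial l (g i j) r t)).

(** (nabla_X Z)^k *)
Definition covd (g : metric) (X Z : vfield) : vfield :=
  fun k r t => sumc (fun i => X i r t *
    (partial i (Z k) r t
     + sumc (fun j => christoffel g k i j r t * Z j r t))).

(** Ric_{jk}, positive on round spheres. *)
Definition ricci (g : metric) (j k : coord) : scalar :=
  fun r t => sumc (fun l =>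
    partial l (christoffel g l j k) r t - partial k (christoffel g l j l) r t
    + sumc (fun m =>
        christoffel g l l m r t * christoffel g m j k r t
        - christoffel g l k m r t * christoffel g m j l r t)).

Definition flat (g : metric) (X : vfield) : oneform :=
  fun i r t => sumc (fun j => g i j r t * X j r t).

Definition sharp (g : metric) (al : oneform) : vfield :=
  fun i r t => sumc (fun j => ginv g i j r t * al j r t).

Definition ricci1 (g : metric) (al : oneform) : oneform :=
  fun i r t => sumc (fun j => ricci g i j r t * sharp g al j r t).

Definition d0 (f : scalar) : oneform := fun i => partial i f.

Definition d1 (al : oneform) : twoform :=
  fun r t => partial Cr (al Ct) r t - partial Ct (al Cr) r t.

(** Hodge star on k-forms, for Vol = sqrt (det g) dr /\ dtheta. *)
Definition star0 (g : metric) (f : scalar) : twoform :=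
  fun r t => f r t * sqrt (detg g r t).

Definition star1 (g : metric) (al : oneform) : oneform :=
  fun j r t => sqrt (detg g r t) * sumc (fun i => sharp g al i r t * eps2 i j).

Definition star2 (g : metric) (w : twoform) : scalar :=
  fun r t => w r t / sqrt (detg g r t).

(** The formal adjoint d^* = - * d * on 1-forms and on 2-forms. *)
Definition codiff1 (g : metric) (al : oneform) : scalar :=
  fun r t => - star2 g (d1 (star1 g al)) r t.

Definition codiff2 (g : metric) (w : twoform) : oneform :=
  fun i r t => - star1 g (d0 (star2 g w)) i r t.

Definition hodge_laplacian (g : metric) (al : oneform) : oneform :=
  fun i r t => d0 (codiff1 g al) i r t + codiff2 g (d1 al) i r t.

(** C^k and C^infinity on an open set of the plane. *)
Fixpoint Ck2_on (k : nat) (D : R -> R -> Prop) (f : scalar) : Prop :=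
  match k with
  | 0%nat => forall r t, D r t -> continuity_2d_pt f r t
  | S k' =>
      (forall r t, D r t ->
         ex_derive (fun x => f x t) r /\ ex_derive (fun y => f r y) t) /\
      Ck2_on k' D (partial Cr f) /\ Ck2_on k' D (partial Ct f)
  end.

Definition smooth2_on (D : R -> R -> Prop) (f : scalar) : Prop :=
  forall k, Ck2_on k D f.

(** * The stationary Navier-Stokes equation on the rotating sphere *)

Definition chart_partial (i : coord) (Phi : R -> R -> R3) (r t : R) : R3 :=
  (partial i (fun x y => c1 (Phi x y)) r t,
   partial i (fun x y => c2 (Phi x y)) r t,
   partial i (fun x y => c3 (Phi x y)) r t).

(** The metric induced from R^3, in the chart [Phi]. *)
Definition induced_metric (Phi : R -> R -> R3) : metric :=
  fun i j r t => dot3 (chart_partial i Phi r t) (chart_partial j Phi r t).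

Definition polar_metric (a : R) (O e1 e2 : R3) : metric :=
  induced_metric (polar_chart a O e1 e2).

Definition polar_domain (a : R) (O e1 e2 : R3) (D : R3 -> Prop) (r t : R) : Prop :=
  exists p, D p /\ has_polar_coord a O e1 e2 p r t.

(** Left-hand side of the momentum equation; [P] is the pressure in
    coordinates. *)
Definition momentum (a nu beta : R) (g : metric) (u : vfield) (P : scalar) : oneform :=
  fun i r t =>
    nu * (hodge_laplacian g (flat g u) i r t - 2 * ricci1 g (flat g u) i r t)
    + beta * cos (a * r) * star1 g (flat g u) i r t
    + flat g (covd g u u) i r t
    + d0 P i r t.

(** [u] is given by its components in the frame of the polar coordinates, which
    are defined throughout the region [D] considered. *)
Definition solves_navier_stokes (a nu beta : R) (O e1 e2 : R3)
    (D : R3 -> Prop) (u : vfield) : Prop :=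
  exists P : R3 -> R,
    let Pc := fun r t => P (polar_chart a O e1 e2 r t) in
    let g := polar_metric a O e1 e2 in
    smooth2_on (polar_domain a O e1 e2 D) Pc /\
    forall p r t, D p -> has_polar_coord a O e1 e2 p r t ->
      (forall i, momentum a nu beta g u Pc i r t = 0) /\
      codiff1 g (flat g u) r t = 0.

Definition laminar_flow (a : R) (Y : R -> R) : vfield :=
  fun i r t => match i with
               | Cr => 0
               | Ct => - Y r * (a / sin (a * r))
               end.

(** * Functions on an interval

    Functions on an interval [I] are total functions of which only the values on
    [I] matter; [D_in] is the derivative relative to [I], one-sided at an
    endpoint. *)

Fixpoint is_nth_derivative_on (n : nat) (I : R -> Prop) (f fn : R -> R) : Prop :=
  match n with
  | 0%nat => forall x, I x -> fn x = f x
  | S n' => exists h, is_nth_derivative_on n' I f h /\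
                      forall x, I x -> D_in h fn I x
  end.

Definition smooth_on (I : R -> Prop) (f : R -> R) : Prop :=
  forall n, exists fn, is_nth_derivative_on n I f fn.

Definition nth_derivative_at (n : nat) (I : R -> Prop) (f : R -> R) (x l : R) : Prop :=
  exists fn, is_nth_derivative_on n I f fn /\ fn x = l.

Definition real_analytic_on (I : R -> Prop) (f : R -> R) : Prop :=
  forall x0, I x0 ->
    exists (c : nat -> R) (rho : posreal),
      forall x, I x -> Rabs (x - x0) < rho -> is_pseries c (x - x0) (f x).

Definition profile_interval (a delta : R) (r : R) : Prop := delta <= r < PI / a.

Definition laminar_profile (a nu beta : R) (O e1 e2 : R3)
    (delta tau alpha1 alpha2 : R) (Y : R -> R) : Prop :=
  smooth_on (profile_interval a delta) Y /\
  Y delta = 0 /\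
  nth_derivative_at 1 (profile_interval a delta) Y delta alpha1 /\
  nth_derivative_at 2 (profile_interval a delta) Y delta (- alpha2) /\
  solves_navier_stokes a nu beta O e1 e2
    (exterior_region a O e1 e2 delta tau) (laminar_flow a Y).

(* Main.v *)
Require Import Defs.

(** For a flow [- Y (a / sin) d/dtheta] the angular component of the momentum
    equation reads [nu / a * L Y + dP/dtheta = 0], where
    [L Y = sin Y'' + a cos Y' + (2 a^2 sin - a^2 / sin) Y] (all trigonometric
    functions taken at [a r]), and the radial one prescribes [dP/dr] as a function
    of [r] alone.  A pressure therefore exists on the simply connected region iff
    [L Y] is a constant [C], and then [P = G(r) - (nu C / a) theta]; the initial
    data determine [C].  Since [sin] solves [L Y = 0], reduction of order with
    [Y = sin V] turns [L Y = C] into [(sin^3 V')' = C sin].  This gives uniqueness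
    and the analytic solution with
    [V' = (D - (C / a) cos) / sin^3].

    The geodesic distance is computed by comparing the length of a curve with the
    variation of the angle between its points and [O]. *)

(** * Polar coordinates on the sphere *)

(** A pressure linear in [theta] is tolerable only because the sector stops short of a full turn;
    around a whole annulus it would be multivalued unless [C = 0]. The free constant [C] gives the
    profile equation three parameters, to match the three data at [delta]: there [Y] vanishes, and
    the equation reads [C = - alpha2 sin (a delta) + a alpha1 cos (a delta)]. That [sin] solves
    [L Y = 0] has a geometric origin: this profile is a rigid rotation, a Killing field, on which
    the viscous operator vanishes.

    Existence and uniqueness treat the endpoint differently. The constructed profile is analytic on
    all of [(0, PI / a)], so [delta] is an interior point for it and ordinary derivatives serve; the
    price is a power series for [1 / sin]. A competing profile has only one-sided derivatives at
    [delta] and obeys the equation only for [r > delta], so identities are proved on the open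
    interval and then compared with the data by a limit from the right. *)

Definition polar_point (a : R) (O e1 e2 : R3) (r t : R) : R3 :=
  add3 (scal3 (cos (a * r)) O)
       (scal3 (sin (a * r) / a) (add3 (scal3 (cos t) e1) (scal3 (sin t) e2))).

Lemma sin2_cos2_pow (x : R) : sin x ^ 2 + cos x ^ 2 = 1.
Proof. rewrite <- !Rsqr_pow2. apply sin2_cos2. Qed.

Lemma norm3_nonneg (v : R3) : 0 <= norm3 v.
Proof. apply sqrt_pos. Qed.

Lemma norm3_sqr (v : R3) : norm3 v ^ 2 = dot3 v v.
Proof.
unfold norm3. rewrite pow2_sqrt; trivial. unfold dot3. nra.
Qed.

Lemma norm3_unique (v : R3) (k : R) : 0 <= k -> dot3 v v = k ^ 2 -> norm3 v = k.
Proof. intros hk E. unfold norm3. rewrite E. apply sqrt_pow2; trivial. Qed.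

Lemma dot3_comm (p q : R3) : dot3 p q = dot3 q p.
Proof. unfold dot3; ring. Qed.

Lemma dot3_add_l (p q s : R3) : dot3 (add3 p q) s = dot3 p s + dot3 q s.
Proof. unfold dot3, add3, c1, c2, c3; simpl; ring. Qed.

Lemma dot3_add_r (p q s : R3) : dot3 s (add3 p q) = dot3 s p + dot3 s q.
Proof. unfold dot3, add3, c1, c2, c3; simpl; ring. Qed.

Lemma dot3_scal_l (k : R) (p q : R3) : dot3 (scal3 k p) q = k * dot3 p q.
Proof. unfold dot3, scal3, c1, c2, c3; simpl; ring. Qed.

Lemma dot3_scal_r (k : R) (p q : R3) : dot3 p (scal3 k q) = k * dot3 p q.
Proof. unfold dot3, scal3, c1, c2, c3; simpl; ring. Qed.

Lemma R3_ext (p q : R3) : c1 p = c1 q -> c2 p = c2 q -> c3 p = c3 q -> p = q.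
Proof.
destruct p as [[? ?] ?], q as [[? ?] ?]; unfold c1, c2, c3; simpl.
now intros -> -> ->.
Qed.

Lemma sin_pos_radius (a r : R) : 0 < a -> 0 < r < PI / a -> 0 < sin (a * r).
Proof.
intros ha [h0 h1]. apply sin_gt_0; [nra|].
apply (Rmult_lt_compat_l a) in h1; trivial.
now replace (a * (PI / a)) with PI in h1 by (field; lra).
Qed.

Lemma mult_radius_lt_PI (a r : R) : 0 < a -> r < PI / a -> a * r < PI.
Proof.
intros ha h. apply (Rmult_lt_compat_l a) in h; trivial.
now replace (a * (PI / a)) with PI in h by (field; lra).
Qed.

(** The tangent vector with polar coordinates [(r, t)] has norm [r]. Derivatives are later taken on
    [polar_point], which is free of the square root and the quotient inside [sphere_exp]. *)
Lemma polar_chart_point (a : R) (O e1 e2 : R3) (r t : R) :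
  0 < a -> oriented_tangent_basis O e1 e2 -> 0 < r ->
  polar_chart a O e1 e2 r t = polar_point a O e1 e2 r t.
Proof.
intros ha (_ & _ & h11 & h22 & h12 & _) hr.
unfold polar_chart, sphere_exp, polar_point.
rewrite (norm3_unique _ r).
- apply R3_ext; unfold add3, scal3, c1, c2, c3; simpl; field; lra.
- lra.
- rewrite !dot3_add_l, !dot3_add_r, !dot3_scal_l, !dot3_scal_r, (dot3_comm e2 e1),
    h11, h22, h12.
  transitivity (r ^ 2 * (sin t ^ 2 + cos t ^ 2)); [ring|].
  rewrite sin2_cos2_pow; ring.
Qed.

Lemma dot3_polar_point (a : R) (O e1 e2 : R3) (r t : R) :
  0 < a -> sphere a O -> oriented_tangent_basis O e1 e2 ->
  let p := polar_point a O e1 e2 r t in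
  dot3 p O = cos (a * r) / a ^ 2 /\
  dot3 p e1 = sin (a * r) / a * cos t /\
  dot3 p e2 = sin (a * r) / a * sin t.
Proof.
intros ha hO (hO1 & hO2 & h11 & h22 & h12 & _). cbv zeta.
unfold polar_point, sphere in *.
rewrite !dot3_add_l, !dot3_scal_l, !dot3_add_l, !dot3_scal_l,
  (dot3_comm e2 e1), (dot3_comm e1 O), (dot3_comm e2 O), hO, hO1, hO2, h11, h22, h12.
split; [|split]; field; lra.
Qed.

Lemma sphere_polar_point (a : R) (O e1 e2 : R3) (r t : R) :
  0 < a -> sphere a O -> oriented_tangent_basis O e1 e2 ->
  sphere a (polar_point a O e1 e2 r t).
Proof.
intros ha hO hb.
destruct (dot3_polar_point a O e1 e2 r t ha hO hb) as (E0 & E1 & E2).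
unfold sphere. unfold polar_point at 2.
rewrite dot3_add_r, !dot3_scal_r, dot3_add_r, !dot3_scal_r, E0, E1, E2.
transitivity (/ a ^ 2 * (cos (a * r) ^ 2
   + sin (a * r) ^ 2 * (sin t ^ 2 + cos t ^ 2))); [field; lra|].
rewrite sin2_cos2_pow, Rmult_1_r, Rplus_comm, sin2_cos2_pow. field. lra.
Qed.

(** Points of the sphere have norm [1 / a], so [a ^ 2 * dot3 p O] is the cosine of the angle at the
    centre, which is [a] times the distance. *)
Definition polar_radius (a : R) (O p : R3) : R := acos (a ^ 2 * dot3 p O) / a.

(* The half-angle formula [cot (theta / 2) = sin theta / (1 - cos theta)] gives
   an expression continuous on the whole plane minus the ray [theta = 0]. *)
Definition polar_angle (e1 e2 p : R3) : R :=
  PI - 2 * atan (dot3 p e2 /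
    (sqrt (dot3 p e1 ^ 2 + dot3 p e2 ^ 2) - dot3 p e1)).

Lemma polar_radius_point (a : R) (O e1 e2 : R3) (r t : R) :
  0 < a -> sphere a O -> oriented_tangent_basis O e1 e2 -> 0 < r < PI / a ->
  polar_radius a O (polar_point a O e1 e2 r t) = r.
Proof.
intros ha hO hb hr.
destruct (dot3_polar_point a O e1 e2 r t ha hO hb) as (E0 & _).
unfold polar_radius. rewrite E0.
replace (a ^ 2 * (cos (a * r) / a ^ 2)) with (cos (a * r)) by (field; lra).
assert (h := mult_radius_lt_PI a r ha (proj2 hr)).
rewrite acos_cos by nra. field. lra.
Qed.

Lemma cos_lt_1_angle (t : R) : 0 < t < 2 * PI -> cos t < 1.
Proof.
intros ht. replace t with (2 * (t / 2)) by lra. rewrite cos_2a_sin.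
assert (0 < sin (t / 2)) by (apply sin_gt_0; lra). nra.
Qed.

Lemma polar_plane_norm (a : R) (O e1 e2 : R3) (r t : R) :
  0 < a -> sphere a O -> oriented_tangent_basis O e1 e2 -> 0 < r < PI / a ->
  let p := polar_point a O e1 e2 r t in
  sqrt (dot3 p e1 ^ 2 + dot3 p e2 ^ 2) = sin (a * r) / a.
Proof.
intros ha hO hb hr; cbv zeta.
destruct (dot3_polar_point a O e1 e2 r t ha hO hb) as (_ & E1 & E2).
rewrite E1, E2.
replace (_ + _) with ((sin (a * r) / a) ^ 2 * (sin t ^ 2 + cos t ^ 2)) by ring.
rewrite sin2_cos2_pow, Rmult_1_r. apply sqrt_pow2.
apply Rlt_le, Rdiv_lt_0_compat; trivial. now apply sin_pos_radius.
Qed.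

Lemma polar_angle_point (a : R) (O e1 e2 : R3) (r t : R) :
  0 < a -> sphere a O -> oriented_tangent_basis O e1 e2 -> 0 < r < PI / a ->
  0 < t < 2 * PI ->
  polar_angle e1 e2 (polar_point a O e1 e2 r t) = t.
Proof.
intros ha hO hb hr ht.
unfold polar_angle. rewrite (polar_plane_norm a O e1 e2 r t) by trivial.
destruct (dot3_polar_point a O e1 e2 r t ha hO hb) as (_ & E1 & E2).
rewrite E1, E2.
assert (hs := sin_pos_radius a r ha hr).
assert (hs2 : 0 < sin (t / 2)) by (apply sin_gt_0; lra).
(* The cotangent of [t / 2] becomes a tangent at [PI / 2 - t / 2], a point where [atan] inverts
   [tan] exactly because [0 < t < 2 * PI]. *)
replace (_ / _) with (tan (PI / 2 - t / 2)).
- rewrite atan_tan by lra. lra.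
- unfold tan. rewrite sin_shift, cos_shift.
  replace (cos t) with (cos (2 * (t / 2))) by (f_equal; lra).
  replace (sin t) with (sin (2 * (t / 2))) by (f_equal; lra).
  rewrite sin_2a, cos_2a_sin. field. repeat split; try lra.
  assert (0 < sin (a * r) * (sin (t / 2) * sin (t / 2)))
    by (repeat apply Rmult_lt_0_compat; trivial).
  lra.
Qed.

Lemma has_polar_coord_unique (a : R) (O e1 e2 p : R3) (r t : R) :
  0 < a -> sphere a O -> oriented_tangent_basis O e1 e2 ->
  has_polar_coord a O e1 e2 p r t ->
  p = polar_point a O e1 e2 r t /\ r = polar_radius a O p /\ t = polar_angle e1 e2 p.
Proof.
intros ha hO hb (hr & ht & E). rewrite polar_chart_point in E by (trivial; lra).
subst p. rewrite polar_radius_point, polar_angle_point; auto.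
Qed.

(** * The geodesic distance *)

Lemma continuous_c1 (p : R3) : continuous c1 p.
Proof. apply (continuous_comp fst fst); apply continuous_fst. Qed.

Lemma continuous_c2 (p : R3) : continuous c2 p.
Proof.
apply (continuous_comp fst snd); [apply continuous_fst|apply continuous_snd].
Qed.

Lemma continuous_c3 (p : R3) : continuous c3 p.
Proof. apply continuous_snd. Qed.

Lemma continuous_triple {U : UniformSpace} (f g h : U -> R) (x : U) :
  continuous f x -> continuous g x -> continuous h x ->
  continuous (fun y => ((f y, g y, h y) : R3)) x.
Proof.
intros hf hg hh.
apply (continuous_comp_2 (fun y => (f y, g y)) h (fun u v => (u, v))); trivial.
- apply (continuous_comp_2 f g (fun u v => (u, v))); trivial.
  apply continuous_ext with (fun z => z); [now intros [? ?]|apply continuous_id].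
- apply continuous_ext with (fun z => z); [now intros [? ?]|apply continuous_id].
Qed.

Lemma continuous_dot3 {U : UniformSpace} (f g : U -> R3) (x : U) :
  continuous f x -> continuous g x -> continuous (fun y => dot3 (f y) (g y)) x.
Proof.
intros hf hg. unfold dot3.
assert (H : forall c : R3 -> R, (forall p, continuous c p) ->
  continuous (fun y => c (f y) * c (g y)) x).
{ intros c hc.
  apply (continuous_mult (fun y => c (f y)) (fun y => c (g y)));
    [apply (continuous_comp f c)|apply (continuous_comp g c)]; auto. }
apply (continuous_plus (fun y => c1 (f y) * c1 (g y) + c2 (f y) * c2 (g y))
  (fun y => c3 (f y) * c3 (g y))).
- apply (continuous_plus (fun y => c1 (f y) * c1 (g y))
    (fun y => c2 (f y) * c2 (g y))); apply H.
  + apply continuous_c1.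
  + apply continuous_c2.
- apply H, continuous_c3.
Qed.

Lemma continuous_norm3 {U : UniformSpace} (f : U -> R3) (x : U) :
  continuous f x -> continuous (fun y => norm3 (f y)) x.
Proof.
intros hf. unfold norm3.
apply (continuous_comp (fun y => dot3 (f y) (f y)) sqrt).
- now apply continuous_dot3.
- apply continuous_sqrt.
Qed.

Lemma is_derive_dot3 (f g : R -> R3) (t : R) (df dg : R3) :
  is_derive3 f t df -> is_derive3 g t dg ->
  is_derive (fun s => dot3 (f s) (g s)) t (dot3 df (g t) + dot3 (f t) dg).
Proof.
intros (f1 & f2 & f3) (g1 & g2 & g3). unfold dot3.
evar_last.
- apply (is_derive_plus (K := R_AbsRing) (V := R_NormedModule)
    (fun s => c1 (f s) * c1 (g s) + c2 (f s) * c2 (g s))).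
  + apply (is_derive_plus (K := R_AbsRing) (V := R_NormedModule)
      (fun s => c1 (f s) * c1 (g s))).
    * apply (is_derive_mult (fun s => c1 (f s))); [apply f1|apply g1|apply Rmult_comm].
    * apply (is_derive_mult (fun s => c2 (f s))); [apply f2|apply g2|apply Rmult_comm].
  + apply (is_derive_mult (fun s => c3 (f s))); [apply f3|apply g3|apply Rmult_comm].
- unfold plus, mult; simpl. unfold plus, mult; simpl. ring.
Qed.

Lemma is_derive3_const (p : R3) (t : R) : is_derive3 (fun _ => p) t (0, 0, 0).
Proof. split; [|split]; apply (is_derive_const (K := R_AbsRing) (V := R_NormedModule)). Qed.

Lemma is_derive_acos (x : R) : -1 < x < 1 -> is_derive acos x (- / sqrt (1 - x ^ 2)).
Proof.
intros hx. apply is_derive_Reals.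
assert (E := derive_pt_acos x hx).
assert (D := derive_pt_eq_1 _ _ _ (derivable_pt_acos x hx) E).
replace (- / sqrt (1 - x ^ 2)) with (-1 / sqrt (1 - x ²)); trivial.
rewrite Rsqr_pow2. unfold Rdiv; ring.
Qed.

(* A tangent vector [v] at [p] meets [O] only through the component of [O]
   orthogonal to [p]. *)
Lemma dot3_tangent_bound (a : R) (p O v : R3) :
  0 < a -> sphere a p -> sphere a O -> dot3 p v = 0 ->
  (a ^ 2 * dot3 v O) ^ 2 <= (a * norm3 v) ^ 2 * (1 - (a ^ 2 * dot3 p O) ^ 2).
Proof.
intros ha hp hO hv. unfold sphere in *.
set (w := add3 O (scal3 (- (a ^ 2 * dot3 p O)) p)).
assert (CS : dot3 v w ^ 2 <= dot3 v v * dot3 w w).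
{ destruct v as [[v1 v2] v3], w as [[w1 w2] w3]. unfold dot3, c1, c2, c3; simpl.
  (* Lagrange's identity: the two sides of the Cauchy-Schwarz inequality differ by the sum of these
     three squares. *)
  assert (H1 := pow2_ge_0 (v1 * w2 - v2 * w1)).
  assert (H2 := pow2_ge_0 (v1 * w3 - v3 * w1)).
  assert (H3 := pow2_ge_0 (v2 * w3 - v3 * w2)). nra. }
assert (E1 : dot3 v w = dot3 v O).
{ unfold w. rewrite dot3_add_r, dot3_scal_r, (dot3_comm v p), hv. ring. }
assert (E2 : dot3 w w = (1 - (a ^ 2 * dot3 p O) ^ 2) / a ^ 2).
{ unfold w. rewrite !dot3_add_l, !dot3_add_r, !dot3_scal_l, !dot3_scal_r,
    (dot3_comm O p), hO, hp. field. lra. }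
rewrite E1, E2 in CS. rewrite Rpow_mult_distr, (Rpow_mult_distr a), norm3_sqr.
apply (Rmult_le_compat_l ((a ^ 2) ^ 2)) in CS; [|apply pow2_ge_0].
eapply Rle_trans; [apply CS|]. right. field. lra.
Qed.

(** The two bounds are [|p + O|^2 >= 0] and [|p - O|^2 >= 0], both points having squared norm
    [1 / a ^ 2]. *)
Lemma sphere_dot3_bound (a : R) (p O : R3) :
  0 < a -> sphere a p -> sphere a O -> -1 <= a ^ 2 * dot3 p O <= 1.
Proof.
intros ha hp hO. unfold sphere in *.
assert (H1 : 0 <= dot3 (add3 p O) (add3 p O)) by (unfold dot3; nra).
assert (H2 : 0 <= dot3 (add3 p (scal3 (-1) O)) (add3 p (scal3 (-1) O)))
  by (unfold dot3; nra).
rewrite !dot3_add_l, !dot3_add_r, (dot3_comm O p), hp, hO in H1.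
rewrite !dot3_add_l, !dot3_add_r, !dot3_scal_l, !dot3_scal_r in H2.
rewrite (dot3_comm O p), hp, hO in H2.
assert (ha2 : 0 < a ^ 2) by nra.
assert (E : a ^ 2 * (1 / a ^ 2) = 1) by (field; lra).
set (k := 1 / a ^ 2) in *. split; nra.
Qed.

(** Differentiates the constant [|gam|^2]. The curve is on the sphere only for parameters in [0,1],
    so constancy in a neighbourhood requires an interior [t]. *)
Lemma sphere_curve_tangent (a : R) (p q : R3) (gam dgam : R -> R3) (t : R) :
  C1_curve_on_sphere a p q gam dgam -> 0 < t < 1 -> dot3 (gam t) (dgam t) = 0.
Proof.
intros (_ & _ & H) ht.
assert (D := is_derive_dot3 gam gam t _ _
  (proj1 (proj2 (H t (conj (Rlt_le _ _ (proj1 ht)) (Rlt_le _ _ (proj2 ht))))))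
  (proj1 (proj2 (H t (conj (Rlt_le _ _ (proj1 ht)) (Rlt_le _ _ (proj2 ht))))))).
assert (D0 : is_derive (fun s => dot3 (gam s) (gam s)) t 0).
{ apply is_derive_ext_loc with (fun _ => 1 / a ^ 2); [|apply @is_derive_const].
  apply (locally_interval _ t 0 1); simpl; try lra.
  intros y h0 h1. symmetry. apply (H y); lra. }
apply is_derive_unique in D. apply is_derive_unique in D0.
rewrite D0, (dot3_comm (dgam t)) in D. lra.
Qed.

(* The derivative of [acos (lam f)], with [f = a^2 <gam, O>], is bounded by the
   speed for every [lam < 1], whereas [acos f] itself need not be differentiable
   where [gam] reaches [O] or its antipode. *)
Lemma curve_length_scaled_acos (a : R) (O p : R3) (gam dgam : R -> R3) (lam : R) :
  0 < a -> sphere a O -> 0 < lam < 1 ->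
  C1_curve_on_sphere a p O gam dgam ->
  acos (lam * (a ^ 2 * dot3 p O)) - acos lam <= a * RInt (fun t => norm3 (dgam t)) 0 1.
Proof.
intros ha hO hl hc.
assert (hc' := hc). destruct hc' as (g0 & g1 & H).
set (f := fun t => a ^ 2 * dot3 (gam t) O).
set (df := fun t => a ^ 2 * dot3 (dgam t) O).
assert (hf : forall t, 0 <= t <= 1 -> -1 <= f t <= 1).
{ intros t ht. apply sphere_dot3_bound; trivial. now apply H. }
assert (hlf : forall t, 0 <= t <= 1 -> -1 < lam * f t < 1).
{ intros t ht. destruct (hf t ht). split; nra. }
assert (Df : forall t, 0 <= t <= 1 -> is_derive f t (df t)).
{ intros t ht. unfold f, df.
  apply (is_derive_scal (fun s => dot3 (gam s) O) t (a ^ 2)).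
  evar_last; [apply is_derive_dot3; [apply (H t ht)|apply is_derive3_const]|].
  unfold dot3 at 2, c1, c2, c3; simpl. ring. }
set (h := fun t => acos (lam * f t)).
set (dh := fun t => - / sqrt (1 - (lam * f t) ^ 2) * (lam * df t)).
assert (Dh : forall t, 0 <= t <= 1 -> is_derive h t (dh t)).
{ intros t ht. unfold h, dh. evar_last.
  - apply (is_derive_comp acos (fun s => lam * f s)).
    + apply is_derive_acos. now apply hlf.
    + apply (is_derive_scal f t lam). now apply Df.
  - unfold scal; simpl. unfold mult; simpl. ring. }
assert (cg : forall t, 0 <= t <= 1 -> continuous (fun s => norm3 (dgam s)) t).
{ intros t ht. apply continuous_norm3. now apply H. }
assert (cf : forall t, 0 <= t <= 1 -> continuous f t).
{ intros t ht. apply (ex_derive_continuous (V := R_NormedModule)). exists (df t). now apply Df. }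
assert (cdf : forall t, 0 <= t <= 1 -> continuous df t).
{ intros t ht. unfold df. apply (continuous_scal_r (a ^ 2) (fun s => dot3 (dgam s) O)).
  apply (continuous_dot3 dgam (fun _ => O)); [now apply H|apply continuous_const]. }
assert (cdh : forall t, 0 <= t <= 1 -> continuous dh t).
{ intros t ht. unfold dh.
  apply (continuous_mult (fun s => - / sqrt (1 - (lam * f s) ^ 2)) (fun s => lam * df s)).
  - apply (continuous_comp f (fun y => - / sqrt (1 - (lam * y) ^ 2))).
    + now apply cf.
    + apply (ex_derive_continuous (V := R_NormedModule)). auto_derive.
      destruct (hlf t ht).
      assert (0 < 1 - (lam * f t) ^ 2) by nra.
      split; [lra|split; trivial]. apply Rgt_not_eq, sqrt_lt_R0. lra.
  - apply (continuous_scal_r lam df). now apply cdf. }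
assert (Ih : is_RInt (fun t => - dh t) 0 1 (h 0 - h 1)).
{ evar_last.
  - apply (is_RInt_derive (fun t => - h t) (fun t => - dh t) 0 1);
      rewrite Rmin_left, Rmax_right by lra; intros t ht.
    + apply (is_derive_opp h). now apply Dh.
    + apply (continuous_opp dh). now apply cdh.
  - unfold minus, plus, opp; simpl. ring. }
replace (acos (lam * (a ^ 2 * dot3 p O))) with (h 0)
  by (unfold h, f; now rewrite g0).
replace (acos lam) with (h 1).
2:{ unfold h, f. rewrite g1. unfold sphere in hO. rewrite hO.
    f_equal. field. lra. }
rewrite <- (is_RInt_unique _ _ _ _ Ih).
assert (eg : ex_RInt (fun t => norm3 (dgam t)) 0 1).
{ apply (ex_RInt_continuous (V := R_CompleteNormedModule)).
  rewrite Rmin_left, Rmax_right by lra. exact cg. }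
replace (a * RInt (fun t => norm3 (dgam t)) 0 1)
  with (RInt (fun t => a * norm3 (dgam t)) 0 1)
  by (apply (RInt_scal (V := R_CompleteNormedModule) _ 0 1 a eg)).
apply RInt_le; [lra|eexists; apply Ih|apply (ex_RInt_scal (V := R_NormedModule) _ 0 1 a eg)|].
intros t ht. assert (ht' : 0 <= t <= 1) by lra.
destruct (hlf t ht') as [b1 b2]. destruct (hf t ht') as [b3 b4].
assert (B := dot3_tangent_bound a (gam t) O (dgam t) ha (proj1 (H t ht')) hO
  (sphere_curve_tangent _ _ _ _ _ t hc ht)).
fold (f t) in B. fold (df t) in B.
unfold dh.
assert (hs : 0 < 1 - (lam * f t) ^ 2) by nra.
assert (hq := sqrt_lt_R0 _ hs).
assert (hq2 := pow2_sqrt _ (Rlt_le _ _ hs)).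
set (q := sqrt (1 - (lam * f t) ^ 2)) in *.
replace (- (- / q * (lam * df t))) with ((lam * df t) / q) by (field; lra).
apply Rle_div_l; trivial.
apply Rsqr_incr_0_var.
2:{ assert (hn := norm3_nonneg (dgam t)).
    apply Rmult_le_pos; [apply Rmult_le_pos|]; lra. }
rewrite !Rsqr_pow2, (Rpow_mult_distr _ q), hq2.
rewrite Rpow_mult_distr.
set (m := (a * norm3 (dgam t)) ^ 2) in *.
assert (0 <= m) by apply pow2_ge_0.
(* The tangent bound is combined with [lam^2 (1 - f^2) <= 1 - lam^2 f^2], which is [lam^2 <= 1]. *)
apply Rle_trans with (lam ^ 2 * (m * (1 - f t ^ 2))).
{ apply Rmult_le_compat_l; [apply pow2_ge_0|exact B]. }
assert (lam ^ 2 < 1) by nra.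
replace (lam ^ 2 * (m * (1 - f t ^ 2))) with (m * (lam ^ 2 * (1 - f t ^ 2))) by ring.
apply Rmult_le_compat_l; trivial. rewrite Rpow_mult_distr. lra.
Qed.

Lemma acos_decreasing (x y : R) : -1 <= x -> y <= 1 -> x <= y -> acos y <= acos x.
Proof.
intros hx hy hxy. destruct (Rle_lt_dec (acos y) (acos x)) as [|h]; trivial.
assert (bx := acos_bound x). assert (by_ := acos_bound y).
assert (C := cos_decreasing_1 (acos x) (acos y)).
rewrite !cos_acos in C by lra. lra.
Qed.

(** Lets [lam = cos eps] tend to 1. Since [cos (phi - eps) >= cos eps * cos phi], the scaled angle
    at [p] is at least [phi - eps], while the one at [O] is [eps]; the bound loses [2 * eps] in
    all. *)
Lemma curve_length_ge_radius (a : R) (O p : R3) (gam dgam : R -> R3) (phi : R) :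
  0 < a -> sphere a O -> 0 < phi < PI -> a ^ 2 * dot3 p O = cos phi ->
  C1_curve_on_sphere a p O gam dgam ->
  phi <= a * RInt (fun t => norm3 (dgam t)) 0 1.
Proof.
intros ha hO hphi E hc. apply le_epsilon. intros eps0 heps0.
(* [eps0 / 2] pays for the two losses, [phi / 2] keeps [phi - eps] inside [[0, PI]], and [PI / 4]
   makes [cos eps] positive. *)
set (eps := Rmin (eps0 / 2) (Rmin (phi / 2) (PI / 4))).
assert (hp := PI_RGT_0).
assert (0 < eps).
{ unfold eps. repeat apply Rmin_pos; lra. }
assert (h1 := Rmin_l (eps0 / 2) (Rmin (phi / 2) (PI / 4))).
assert (h2 := Rmin_r (eps0 / 2) (Rmin (phi / 2) (PI / 4))).
assert (h3 := Rmin_l (phi / 2) (PI / 4)).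
assert (h4 := Rmin_r (phi / 2) (PI / 4)). fold eps in h1, h2.
assert (c0 : 0 < cos eps) by (apply cos_gt_0; lra).
assert (c1 : cos eps < 1) by (rewrite <- cos_0; apply cos_decreasing_1; lra).
assert (L := curve_length_scaled_acos a O p gam dgam (cos eps) ha hO (conj c0 c1) hc).
rewrite E, acos_cos in L by lra.
assert (A : acos (cos (phi - eps)) <= acos (cos eps * cos phi)).
{ apply acos_decreasing.
  - assert (B := COS_bound phi). nra.
  - apply COS_bound.
  - rewrite cos_minus. assert (0 < sin eps) by (apply sin_gt_0; lra).
    assert (0 < sin phi) by (apply sin_gt_0; lra). nra. }
rewrite acos_cos in A by lra. lra.
Qed.

(** The meridian, run towards [O] at constant speed [r], attains the infimum in [sphere_dist]. *)
Lemma polar_geodesic (a : R) (O e1 e2 : R3) (r t : R) :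
  0 < a -> sphere a O -> oriented_tangent_basis O e1 e2 -> 0 < r ->
  exists gam dgam : R -> R3,
    C1_curve_on_sphere a (polar_point a O e1 e2 r t) O gam dgam /\
    r = RInt (fun s => norm3 (dgam s)) 0 1.
Proof.
intros ha hO hb hr.
set (e := add3 (scal3 (cos t) e1) (scal3 (sin t) e2)).
set (dgam := fun s => add3 (scal3 (a * r * sin (a * (r * (1 - s)))) O)
  (scal3 (- r * cos (a * (r * (1 - s)))) e)).
exists (fun s => polar_point a O e1 e2 (r * (1 - s)) t), dgam.
split.
- split; [|split].
  + now replace (r * (1 - 0)) with r by ring.
  + unfold polar_point. replace (a * (r * (1 - 1))) with 0 by ring.
    rewrite cos_0, sin_0.
    apply R3_ext; unfold add3, scal3, c1, c2, c3; simpl; field; lra.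
  + intros s _. split; [|split].
    * now apply sphere_polar_point.
    * unfold dgam, polar_point. fold e.
      split; [|split]; unfold add3, scal3, c1, c2, c3; simpl;
        auto_derive; trivial; fold (Rminus 1 s); field; lra.
    * unfold dgam, add3, scal3.
      apply continuous_triple; apply (ex_derive_continuous (V := R_NormedModule));
      unfold c1, c2, c3; simpl; auto_derive; trivial.
- destruct hb as (hO1 & hO2 & h11 & h22 & h12 & _).
  symmetry. rewrite (RInt_ext _ (fun _ => r)).
  + rewrite RInt_const. unfold scal; simpl. unfold mult; simpl. ring.
  + intros s _. apply norm3_unique; [lra|].
    assert (Oe : dot3 O e = 0).
    { unfold e. rewrite dot3_add_r, !dot3_scal_r, hO1, hO2. ring. }
    assert (ee : dot3 e e = 1).
    { unfold e. rewrite !dot3_add_l, !dot3_add_r, !dot3_scal_l, !dot3_scal_r,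
        (dot3_comm e2 e1), h11, h22, h12. rewrite <- (sin2_cos2_pow t) at 3. ring. }
    unfold dgam. rewrite !dot3_add_l, !dot3_add_r, !dot3_scal_l, !dot3_scal_r,
      (dot3_comm e O), Oe, ee. unfold sphere in hO. rewrite hO.
    transitivity (r ^ 2 * (sin (a * (r * (1 - s))) ^ 2 + cos (a * (r * (1 - s))) ^ 2)).
    * field. lra.
    * rewrite sin2_cos2_pow. ring.
Qed.

Lemma sphere_dist_polar_point (a : R) (O e1 e2 : R3) (r t : R) :
  0 < a -> sphere a O -> oriented_tangent_basis O e1 e2 -> 0 < r < PI / a ->
  sphere_dist a (polar_point a O e1 e2 r t) O = r.
Proof.
intros ha hO hb hr. unfold sphere_dist.
rewrite (is_glb_Rbar_unique _ (Finite r)); trivial.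
split.
- intros l (gam & dgam & hc & ->). simpl.
  apply (Rmult_le_reg_l a); trivial.
  apply (curve_length_ge_radius a O (polar_point a O e1 e2 r t) gam dgam); trivial.
  + split; [nra|now apply mult_radius_lt_PI].
  + rewrite (proj1 (dot3_polar_point a O e1 e2 r t ha hO hb)). field. lra.
- intros l hl. apply hl. apply polar_geodesic; trivial; lra.
Qed.

(** * The exterior region *)

Lemma exterior_region_polar (a : R) (O e1 e2 : R3) (delta tau : R) (p : R3) :
  0 < a -> sphere a O -> oriented_tangent_basis O e1 e2 -> 0 < delta -> tau < 2 * PI ->
  exterior_region a O e1 e2 delta tau p <->
  exists r t, delta < r < PI / a /\ 0 < t < tau /\ p = polar_point a O e1 e2 r t.
Proof.
intros ha hO hb hd htau. split.
- intros (_ & hdist & r & t & hp & ht). exists r, t.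
  assert (hr := proj1 hp).
  destruct (has_polar_coord_unique a O e1 e2 p r t ha hO hb hp) as (-> & _).
  rewrite sphere_dist_polar_point in hdist; auto.
- intros (r & t & hr & ht & ->). split; [|split].
  + now apply sphere_polar_point.
  + rewrite sphere_dist_polar_point; trivial; lra.
  + exists r, t. split; [|trivial]. split; [lra|split; [lra|]].
    rewrite polar_chart_point; trivial; lra.
Qed.

Lemma arc_polar (a : R) (O e1 e2 : R3) (delta tau : R) (p : R3) :
  0 < a -> sphere a O -> oriented_tangent_basis O e1 e2 ->
  arc a O e1 e2 delta tau p ->
  exists t, 0 < t < tau /\ p = polar_point a O e1 e2 delta t.
Proof.
intros ha hO hb (_ & hdist & r & t & hp & ht). exists t. split; trivial.
assert (hr := proj1 hp).
destruct (has_polar_coord_unique a O e1 e2 p r t ha hO hb hp) as (E & _).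
rewrite E, sphere_dist_polar_point in hdist by trivial. now rewrite <- hdist.
Qed.

Lemma polar_domain_exterior (a : R) (O e1 e2 : R3) (delta tau r t : R) :
  0 < a -> sphere a O -> oriented_tangent_basis O e1 e2 -> 0 < delta -> tau < 2 * PI ->
  polar_domain a O e1 e2 (exterior_region a O e1 e2 delta tau) r t <->
  delta < r < PI / a /\ 0 < t < tau.
Proof.
intros ha hO hb hd htau. split.
- intros (p & hp & hc).
  apply exterior_region_polar in hp; trivial.
  destruct hp as (r' & t' & hr' & ht' & E).
  destruct (has_polar_coord_unique a O e1 e2 p r t ha hO hb hc) as (_ & -> & ->).
  rewrite E, polar_radius_point, polar_angle_point by (trivial; lra). auto.
- intros [hr ht]. exists (polar_point a O e1 e2 r t). split.
  + apply exterior_region_polar; trivial. exists r, t; auto.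
  + split; [lra|split; [lra|]]. rewrite polar_chart_point; trivial; lra.
Qed.

Lemma continuous_polar_point {U : UniformSpace} (a : R) (O e1 e2 : R3)
    (f g : U -> R) (x : U) :
  continuous f x -> continuous g x ->
  continuous (fun y => polar_point a O e1 e2 (f y) (g y)) x.
Proof.
intros hf hg.
assert (hc : forall k l1 l2 : R, continuous (fun y => cos (a * f y) * k
  + sin (a * f y) / a * (cos (g y) * l1 + sin (g y) * l2)) x).
{ intros k l1 l2.
  assert (comp : forall (F : R -> R) (h : U -> R),
    (forall z, ex_derive F z) -> continuous h x -> continuous (fun y => F (h y)) x).
  { intros F h hF hh. apply (continuous_comp h F); trivial.
    apply (ex_derive_continuous (V := R_NormedModule)), hF. }
  apply (continuous_plus (fun y => cos (a * f y) * k)).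
  - apply (comp (fun z => cos (a * z) * k)); trivial. intros z. now auto_derive.
  - apply (continuous_mult (fun y => sin (a * f y) / a)).
    + apply (comp (fun z => sin (a * z) / a)); trivial. intros z. now auto_derive.
    + apply (comp (fun z => cos z * l1 + sin z * l2)); trivial.
      intros z. now auto_derive. }
apply continuous_triple; apply hc.
Qed.

Lemma polar_radius_continuous (a : R) (O e1 e2 : R3) (r t : R) :
  0 < a -> sphere a O -> oriented_tangent_basis O e1 e2 -> 0 < r < PI / a ->
  continuous (polar_radius a O) (polar_point a O e1 e2 r t).
Proof.
intros ha hO hb hr.
assert (E := proj1 (dot3_polar_point a O e1 e2 r t ha hO hb)).
assert (hs := sin_pos_radius a r ha hr).
assert (S := sin2_cos2_pow (a * r)).
unfold polar_radius.
apply (continuous_comp (fun p => dot3 p O) (fun z => acos (a ^ 2 * z) / a)).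
- apply (continuous_dot3 (fun p => p) (fun _ => O));
    [apply continuous_id|apply continuous_const].
- apply (ex_derive_continuous (V := R_NormedModule)).
  apply (ex_derive_mult (fun z => acos (a ^ 2 * z)) (fun _ => / a)); [|now auto_derive].
  apply (ex_derive_comp acos (fun z => a ^ 2 * z)); [|now auto_derive].
  eexists. apply is_derive_acos. rewrite E.
  replace (a ^ 2 * (cos (a * r) / a ^ 2)) with (cos (a * r)) by (field; lra).
  split; nra.
Qed.

Lemma polar_angle_continuous (a : R) (O e1 e2 : R3) (r t : R) :
  0 < a -> sphere a O -> oriented_tangent_basis O e1 e2 -> 0 < r < PI / a ->
  0 < t < 2 * PI ->
  continuous (polar_angle e1 e2) (polar_point a O e1 e2 r t).
Proof.
intros ha hO hb hr ht.
destruct (dot3_polar_point a O e1 e2 r t ha hO hb) as (_ & E1 & E2).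
assert (N := polar_plane_norm a O e1 e2 r t ha hO hb hr). cbv zeta in N.
assert (hs := sin_pos_radius a r ha hr).
assert (hc := cos_lt_1_angle t ht).
set (p := polar_point a O e1 e2 r t) in *.
assert (hsa : 0 < sin (a * r) / a) by (apply Rdiv_lt_0_compat; trivial).
assert (cx : forall e, continuous (fun q => dot3 q e) p).
{ intros e. apply (continuous_dot3 (fun q => q) (fun _ => e));
    [apply continuous_id|apply continuous_const]. }
assert (csq : forall e, continuous (fun q => dot3 q e ^ 2) p).
{ intros e. apply (continuous_comp (fun q => dot3 q e) (fun z => z ^ 2)); trivial.
  apply (ex_derive_continuous (V := R_NormedModule)). now auto_derive. }
assert (cd : continuous (fun q =>
  sqrt (dot3 q e1 ^ 2 + dot3 q e2 ^ 2) - dot3 q e1) p).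
{ apply (continuous_minus (fun q => sqrt (dot3 q e1 ^ 2 + dot3 q e2 ^ 2))); trivial.
  apply (continuous_comp (fun q => dot3 q e1 ^ 2 + dot3 q e2 ^ 2) sqrt).
  - now apply (continuous_plus (fun q => dot3 q e1 ^ 2)).
  - apply continuous_sqrt. }
unfold polar_angle.
apply (continuous_comp (fun q => dot3 q e2 / (sqrt (dot3 q e1 ^ 2 + dot3 q e2 ^ 2) - dot3 q e1))
  (fun z => PI - 2 * atan z)).
- apply (continuous_mult (fun q => dot3 q e2)); trivial.
  apply (continuous_comp (fun q => sqrt (dot3 q e1 ^ 2 + dot3 q e2 ^ 2) - dot3 q e1) Rinv);
    trivial.
  apply (ex_derive_continuous (V := R_NormedModule)).
  auto_derive. rewrite N, E1.
  assert (0 < sin (a * r) / a * (1 - cos t)) by (apply Rmult_lt_0_compat; lra). lra.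
- apply (ex_derive_continuous (V := R_NormedModule)). now auto_derive.
Qed.

Lemma convex_comb_between (lo hi x y s : R) :
  lo < x < hi -> lo < y < hi -> 0 <= s <= 1 -> lo < (1 - s) * x + s * y < hi.
Proof.
intros hx hy hs.
assert (H : forall u v, 0 < u -> 0 < v -> 0 < (1 - s) * u + s * v).
(* One of the weights [1 - s] and [s] is at least 1/2, which keeps the combination strictly positive
   even at the ends. *)
{ intros u v hu hv. destruct (Rle_lt_dec s (1 / 2)); nra. }
assert (H1 := H (x - lo) (y - lo)). assert (H2 := H (hi - x) (hi - y)). lra.
Qed.

(* In polar coordinates the region is the open rectangle
   (delta, PI / a) x (0, tau), along which paths contract by segments. *)
Lemma exterior_region_simply_connected (a : R) (O e1 e2 : R3) (delta tau : R) :
  0 < a -> sphere a O -> oriented_tangent_basis O e1 e2 -> 0 < delta < PI / a ->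
  0 < tau < 2 * PI ->
  simply_connected (exterior_region a O e1 e2 delta tau).
Proof.
intros ha hO hb hd htau.
assert (X : forall p, exterior_region a O e1 e2 delta tau p <->
  exists r t, delta < r < PI / a /\ 0 < t < tau /\ p = polar_point a O e1 e2 r t).
{ intros p. apply exterior_region_polar; trivial; lra. }
assert (Xi : forall p, exterior_region a O e1 e2 delta tau p ->
  delta < polar_radius a O p < PI / a /\ 0 < polar_angle e1 e2 p < tau /\
  polar_point a O e1 e2 (polar_radius a O p) (polar_angle e1 e2 p) = p /\
  continuous (polar_radius a O) p /\ continuous (polar_angle e1 e2) p).
{ intros p hp. apply X in hp. destruct hp as (r & t & hr & ht & ->).
  rewrite polar_radius_point, polar_angle_point by (trivial; lra).
  repeat split; try lra.
  - apply polar_radius_continuous; trivial; lra.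
  - apply polar_angle_continuous; trivial; lra. }
assert (hseg : forall r t r' t' s, delta < r < PI / a -> 0 < t < tau ->
  delta < r' < PI / a -> 0 < t' < tau -> 0 <= s <= 1 ->
  exterior_region a O e1 e2 delta tau
    (polar_point a O e1 e2 ((1 - s) * r + s * r') ((1 - s) * t + s * t'))).
{ intros. apply X. do 2 eexists. split; [|split; [|reflexivity]];
    now apply convex_comb_between. }
split; [|split].
- exists (polar_point a O e1 e2 ((delta + PI / a) / 2) (tau / 2)). apply X.
  do 2 eexists. split; [|split; [|reflexivity]]; lra.
- intros p q hp hq.
  destruct (Xi p hp) as (h1 & h2 & h3 & _). destruct (Xi q hq) as (k1 & k2 & k3 & _).
  exists (fun s => polar_point a O e1 e2
    ((1 - s) * polar_radius a O p + s * polar_radius a O q)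
    ((1 - s) * polar_angle e1 e2 p + s * polar_angle e1 e2 q)).
  split; [|split].
  + rewrite <- h3 at 3. f_equal; ring.
  + rewrite <- k3 at 3. f_equal; ring.
  + intros s hs. split; [now apply hseg|].
    apply continuous_polar_point; apply (ex_derive_continuous (V := R_NormedModule));
      now auto_derive.
- intros p gam (g0 & g1 & hg).
  assert (hp : exterior_region a O e1 e2 delta tau p).
  { rewrite <- g0. apply hg. lra. }
  destruct (Xi p hp) as (h1 & h2 & h3 & _).
  set (H := fun z : R * R => polar_point a O e1 e2
    ((1 - fst z) * polar_radius a O (gam (snd z)) + fst z * polar_radius a O p)
    ((1 - fst z) * polar_angle e1 e2 (gam (snd z)) + fst z * polar_angle e1 e2 p)).
  exists H. split; [|split].
  + intros s t hs ht. destruct (hg t ht) as [ht1 ht2].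
    destruct (Xi _ ht1) as (k1 & k2 & k3 & k4 & k5).
    split; [now apply hseg|].
    assert (C : forall (F : R3 -> R) (k : R), continuous F (gam t) ->
      continuous (fun z : R * R => (1 - fst z) * F (gam (snd z)) + fst z * k) (s, t)).
    { intros F k hF.
      assert (cs : continuous (fun z : R * R => F (gam (snd z))) (s, t)).
      { apply (continuous_comp (fun z : R * R => snd z) (fun y => F (gam y))).
        - apply continuous_snd.
        - now apply (continuous_comp gam F). }
      apply (continuous_plus (fun z : R * R => (1 - fst z) * F (gam (snd z)))).
      - apply (continuous_mult (fun z : R * R => 1 - fst z)); trivial.
        apply (continuous_minus (fun _ => 1) (fun z : R * R => fst z));
          [apply continuous_const|apply continuous_fst].
      - apply (continuous_mult (fun z : R * R => fst z));
          [apply continuous_fst|apply continuous_const]. }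
    apply continuous_polar_point; now apply C.
  + intros t ht. destruct (Xi _ (proj1 (hg t ht))) as (_ & _ & k3 & _).
    unfold H; simpl. split.
    * rewrite <- k3 at 3. f_equal; ring.
    * rewrite <- h3 at 3. f_equal; ring.
  + intros s hs. unfold H; simpl. rewrite g0, g1.
    split; rewrite <- h3 at 5; f_equal; ring.
Qed.

(** Moving outwards along the meridian enters the region at once, while the arc point itself, at
    distance exactly [delta], is outside it. *)
Lemma arc_boundary_exterior (a : R) (O e1 e2 : R3) (delta tau : R) (p : R3) :
  0 < a -> sphere a O -> oriented_tangent_basis O e1 e2 -> 0 < delta < PI / a ->
  tau < 2 * PI ->
  arc a O e1 e2 delta tau p ->
  sphere_boundary a (exterior_region a O e1 e2 delta tau) p.
Proof.
intros ha hO hb hd htau hp. assert (hp' := hp).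
apply arc_polar in hp; trivial. destruct hp as (t & ht & E).
split; [apply hp'|]. intros eps. split.
- assert (C : continuous (fun r => polar_point a O e1 e2 r t) delta).
  { apply continuous_polar_point; [apply continuous_id|apply continuous_const]. }
  rewrite E. destruct (C _ (locally_ball _ eps)) as [rho hrho].
  set (m := Rmin (rho / 2) ((PI / a - delta) / 2)).
  assert (hrho0 := cond_pos rho).
  assert (m1 := Rmin_l (rho / 2) ((PI / a - delta) / 2)).
  assert (m2 := Rmin_r (rho / 2) ((PI / a - delta) / 2)).
  assert (m0 : 0 < m) by (apply Rmin_pos; lra). fold m in m1, m2.
  exists (polar_point a O e1 e2 (delta + m) t). split; [|split].
  + apply hrho. unfold ball; simpl. unfold AbsRing_ball, abs, minus, plus, opp; simpl.
    replace (delta + m + - delta) with m by ring. rewrite Rabs_pos_eq; lra.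
  + now apply sphere_polar_point.
  + apply exterior_region_polar; trivial; try lra.
    exists (delta + m), t. split; [lra|auto].
- exists p. split; [apply ball_center|split; [apply hp'|]].
  intros (_ & h & _). destruct hp' as (_ & h' & _). lra.
Qed.

(** * The momentum equation in polar coordinates *)

(** The angle is left unrestricted, so that on each circle [f] is constant on the whole line and its
    [Ct]-derivative vanishes without any localization. *)
Definition radial_on (I : R -> Prop) (f : scalar) (F : R -> R) : Prop :=
  forall r t, I r -> f r t = F r.

Lemma radial_partial_r (lo hi : R) (f : scalar) (F : R -> R) (r t l : R) :
  radial_on (fun x => lo < x < hi) f F -> lo < r < hi ->
  is_derive F r l -> partial Cr f r t = l.
Proof.
intros hf hr hF. apply is_derive_unique.
apply is_derive_ext_loc with F; trivial.
apply (locally_interval _ r lo hi); simpl; try apply hr.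
intros y h1 h2. symmetry. now apply hf.
Qed.

Lemma radial_partial_t (I : R -> Prop) (f : scalar) (F : R -> R) (r t : R) :
  radial_on I f F -> I r -> partial Ct f r t = 0.
Proof.
intros hf hr. unfold partial. rewrite (Derive_ext _ (fun _ => F r)).
- apply Derive_const.
- intros y. now apply hf.
Qed.

Lemma chart_partial_polar (a : R) (O e1 e2 : R3) (r t : R) :
  0 < a -> oriented_tangent_basis O e1 e2 -> 0 < r ->
  let Phi := polar_chart a O e1 e2 in
  chart_partial Cr Phi r t =
    add3 (scal3 (- a * sin (a * r)) O)
         (scal3 (cos (a * r)) (add3 (scal3 (cos t) e1) (scal3 (sin t) e2))) /\
  chart_partial Ct Phi r t =
    scal3 (sin (a * r) / a) (add3 (scal3 (- sin t) e1) (scal3 (cos t) e2)).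
Proof.
intros ha hb hr Phi.
assert (Er : forall (c : R3 -> R) l,
  is_derive (fun x => c (polar_point a O e1 e2 x t)) r l ->
  partial Cr (fun x y => c (Phi x y)) r t = l).
{ intros c l hl. apply is_derive_unique.
  apply is_derive_ext_loc with (2 := hl).
  apply (locally_interval _ r 0 p_infty); simpl; trivial.
  intros y hy _. unfold Phi. now rewrite polar_chart_point. }
assert (Et : forall (c : R3 -> R) l,
  is_derive (fun y => c (polar_point a O e1 e2 r y)) t l ->
  partial Ct (fun x y => c (Phi x y)) r t = l).
{ intros c l hl. apply is_derive_unique.
  apply is_derive_ext with (2 := hl).
  intros y. unfold Phi. now rewrite polar_chart_point. }
split; apply R3_ext;
  [refine (Er c1 _ _)|refine (Er c2 _ _)|refine (Er c3 _ _)
  |refine (Et c1 _ _)|refine (Et c2 _ _)|refine (Et c3 _ _)]; unfold polar_point, add3, scal3, c1, c2, c3; simpl;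
  auto_derive; trivial; field; lra.
Qed.

Lemma polar_metric_eq (a : R) (O e1 e2 : R3) (i j : coord) (r t : R) :
  0 < a -> sphere a O -> oriented_tangent_basis O e1 e2 -> 0 < r ->
  polar_metric a O e1 e2 i j r t =
  match i, j with
  | Cr, Cr => 1
  | Ct, Ct => (sin (a * r) / a) ^ 2
  | _, _ => 0
  end.
Proof.
intros ha hO hb hr. unfold polar_metric, induced_metric.
destruct (chart_partial_polar a O e1 e2 r t ha hb hr) as [Er Et]. cbv zeta in Er, Et.
destruct hb as (hO1 & hO2 & h11 & h22 & h12 & _). unfold sphere in hO.
assert (T := sin2_cos2_pow t). assert (S := sin2_cos2_pow (a * r)).
destruct i, j; rewrite ?Er, ?Et, ?dot3_scal_l, ?dot3_scal_r, ?dot3_add_l, ?dot3_add_r,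
  ?dot3_scal_l, ?dot3_scal_r, ?dot3_add_l, ?dot3_add_r, ?dot3_scal_l, ?dot3_scal_r,
  ?(dot3_comm e1 O), ?(dot3_comm e2 O), ?(dot3_comm e2 e1), ?hO1, ?hO2, ?h11, ?h22, ?h12,
  ?hO.
- transitivity (sin (a * r) ^ 2 + cos (a * r) ^ 2 * (sin t ^ 2 + cos t ^ 2)).
  + field. lra.
  + rewrite T. lra.
- ring.
- ring.
- transitivity ((sin (a * r) / a) ^ 2 * (sin t ^ 2 + cos t ^ 2)).
  + field. lra.
  + rewrite T. ring.
Qed.

Definition polar_interval (a lo r : R) : Prop := lo < r < PI / a.

(** From here on the embedding in space and the frame are forgotten: the calculus uses only these
    coefficients. *)
Definition is_polar_metric (a lo : R) (g : metric) : Prop :=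
  forall i j, radial_on (polar_interval a lo) (g i j)
    (fun r => match i, j with
              | Cr, Cr => 1
              | Ct, Ct => (sin (a * r) / a) ^ 2
              | _, _ => 0
              end).

Section PolarCalculus.

Context (a lo : R) (g : metric).
Hypothesis ha : 0 < a.
Hypothesis hlo : 0 <= lo.
Hypothesis hg : is_polar_metric a lo g.

Let I := polar_interval a lo.

Lemma polar_interval_sin_pos (r : R) : I r -> 0 < sin (a * r).
Proof. intros [h1 h2]. apply sin_pos_radius; lra. Qed.

Lemma polar_detg (r t : R) : I r -> detg g r t = (sin (a * r) / a) ^ 2.
Proof. intros hr. unfold detg. rewrite !hg by trivial. ring. Qed.

Lemma polar_sqrt_detg (r t : R) : I r -> sqrt (detg g r t) = sin (a * r) / a.
Proof.
intros hr. rewrite polar_detg by trivial. apply sqrt_pow2, Rlt_le.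
apply Rdiv_lt_0_compat; trivial. now apply polar_interval_sin_pos.
Qed.

Lemma polar_ginv (i j : coord) : radial_on I (ginv g i j)
  (fun r => match i, j with
            | Cr, Cr => 1
            | Ct, Ct => (a / sin (a * r)) ^ 2
            | _, _ => 0
            end).
Proof.
intros r t hr. assert (hs := polar_interval_sin_pos r hr).
unfold ginv. destruct i, j; rewrite polar_detg, !hg by trivial; field; lra.
Qed.

Lemma polar_partial_metric (l i j : coord) : radial_on I (partial l (g i j))
  (fun r => match l, i, j with
            | Cr, Ct, Ct => 2 * sin (a * r) * cos (a * r) / a
            | _, _, _ => 0
            end).
Proof.
intros r t hr. destruct l.
- apply (radial_partial_r _ _ _ _ _ _ _ (hg i j)); trivial.
  destruct i, j; auto_derive; trivial; field; lra.
- now apply (radial_partial_t _ _ _ _ _ (hg i j)).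
Qed.

Lemma polar_christoffel (k i j : coord) : radial_on I (christoffel g k i j)
  (fun r => match k, i, j with
            | Cr, Ct, Ct => - (sin (a * r) * cos (a * r) / a)
            | Ct, Cr, Ct | Ct, Ct, Cr => a * cos (a * r) / sin (a * r)
            | _, _, _ => 0
            end).
Proof.
intros r t hr. assert (hs := polar_interval_sin_pos r hr).
unfold christoffel, sumc. rewrite !polar_ginv, !polar_partial_metric by trivial.
destruct k, i, j; field; lra.
Qed.

Lemma polar_ricci (i j : coord) (r t : R) : I r ->
  ricci g i j r t = a ^ 2 * g i j r t.
Proof.
intros hr. assert (hs := polar_interval_sin_pos r hr).
(* The factor [sin^2 + cos^2] is left unreduced, so that the curvature identities below are rational
   identities in [sin] and [cos]. *)
assert (D : forall k l m, partial Cr (christoffel g k l m) r t =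
  match k, l, m with
  | Cr, Ct, Ct => sin (a * r) ^ 2 - cos (a * r) ^ 2
  | Ct, Cr, Ct | Ct, Ct, Cr =>
      - a ^ 2 * (sin (a * r) ^ 2 + cos (a * r) ^ 2) / sin (a * r) ^ 2
  | _, _, _ => 0
  end).
{ intros k l m.
  apply (radial_partial_r _ _ _ _ _ _ _ (polar_christoffel k l m)); trivial.
  destruct k, l, m; auto_derive; trivial; try lra; field; lra. }
assert (Dt : forall k l m, partial Ct (christoffel g k l m) r t = 0).
{ intros k l m. now apply (radial_partial_t _ _ _ _ _ (polar_christoffel k l m)). }
unfold ricci, sumc.
destruct i, j; rewrite !D, ?Dt, !polar_christoffel, hg by trivial; field; lra.
Qed.


Lemma polar_star1 (al : oneform) (A : coord -> R -> R) :
  (forall i, radial_on I (al i) (A i)) ->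
  forall i, radial_on I (star1 g al i)
    (fun r => match i with
              | Cr => - (a / sin (a * r)) * A Ct r
              | Ct => sin (a * r) / a * A Cr r
              end).
Proof.
intros hal i r t hr. assert (hs := polar_interval_sin_pos r hr).
unfold star1, sharp, sumc. rewrite polar_sqrt_detg, !polar_ginv, !hal by trivial.
destruct i; simpl; field; lra.
Qed.

Lemma polar_star2 (w : twoform) (W : R -> R) :
  radial_on I w W -> radial_on I (star2 g w) (fun r => W r * (a / sin (a * r))).
Proof.
intros hw r t hr. assert (hs := polar_interval_sin_pos r hr).
unfold star2. rewrite polar_sqrt_detg, hw by trivial. field. lra.
Qed.

Lemma radial_d1 (al : oneform) (A : coord -> R -> R) (dA : R -> R) :
  (forall i, radial_on I (al i) (A i)) ->
  (forall r, I r -> is_derive (A Ct) r (dA r)) ->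
  radial_on I (d1 al) dA.
Proof.
intros hal hd r t hr. unfold d1.
rewrite (radial_partial_r _ _ _ _ r t _ (hal Ct) hr (hd r hr)).
rewrite (radial_partial_t _ _ _ r t (hal Cr) hr). ring.
Qed.

Lemma radial_d0 (f : scalar) (F dF : R -> R) :
  radial_on I f F -> (forall r, I r -> is_derive F r (dF r)) ->
  forall i, radial_on I (d0 f i) (fun r => match i with Cr => dF r | Ct => 0 end).
Proof.
intros hf hd i r t hr. unfold d0. destruct i.
- exact (radial_partial_r _ _ _ _ r t _ hf hr (hd r hr)).
- exact (radial_partial_t _ _ _ r t hf hr).
Qed.

(** * Divergence, viscosity and convection of a laminar flow *)

Section LaminarFlow.

Context (Y Y1 Y2 : R -> R).
Hypothesis hY : forall r, I r -> is_derive Y r (Y1 r).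
Hypothesis hY1 : forall r, I r -> is_derive Y1 r (Y2 r).

Let u := laminar_flow a Y.

Lemma laminar_flat (i : coord) : radial_on I (flat g u i)
  (fun r => match i with Cr => 0 | Ct => - Y r * sin (a * r) / a end).
Proof.
intros r t hr. assert (hs := polar_interval_sin_pos r hr).
unfold flat, sumc, u, laminar_flow. rewrite !hg by trivial.
destruct i; field; lra.
Qed.

(** The star of a purely angular form is [dr] times a function of [r], hence closed. *)
Lemma laminar_codiff1 : radial_on I (codiff1 g (flat g u)) (fun _ => 0).
Proof.
intros r t hr. unfold codiff1.
rewrite (polar_star2 _ (fun _ => 0)); [ring| |trivial].
apply radial_d1 with (1 := polar_star1 _ _ laminar_flat).
intros x _. auto_derive; [lra|ring].
Qed.

Lemma laminar_codiff2 (i : coord) : radial_on I (codiff2 g (d1 (flat g u)) i)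
  (fun r => match i with
            | Cr => 0
            | Ct => (sin (a * r) * Y2 r + a * cos (a * r) * Y1 r
                     - a ^ 2 / sin (a * r) * Y r) / a
            end).
Proof.
assert (E : forall r, I r -> Derive (fun x : R => Y x) r = Y1 r)
  by (intros r hr; apply is_derive_unique, hY, hr).
assert (E1 : forall r, I r -> Derive (fun x : R => Y1 x) r = Y2 r)
  by (intros r hr; apply is_derive_unique, hY1, hr).
(* The vorticity: the coefficient of [d u^*], that is, the derivative of [- Y sin / a]. *)
set (W := fun r => - (Y1 r * sin (a * r) / a + Y r * cos (a * r))).
assert (hW : radial_on I (d1 (flat g u)) W).
{ apply radial_d1 with (1 := laminar_flat). intros r hr. unfold W.
  auto_derive; [now exists (Y1 r); apply hY|].
  rewrite E by trivial. field. lra. }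
assert (hdW : forall i, radial_on I (d0 (star2 g (d1 (flat g u))) i)
  (fun r => match i with
            | Cr => - (Y2 r + a * cos (a * r) / sin (a * r) * Y1 r
                       - a ^ 2 / sin (a * r) ^ 2 * Y r)
            | Ct => 0
            end)).
{ apply radial_d0 with (1 := polar_star2 _ _ hW). intros r hr.
  assert (hs := polar_interval_sin_pos r hr). unfold W.
  auto_derive.
  - repeat split; try lra; [now exists (Y2 r); apply hY1|now exists (Y1 r); apply hY].
  - rewrite E, E1 by trivial.
    (* The derivative of [cos / sin] comes out with numerator [sin^2 + cos^2]; the target is put in
       the same form for [field]. *)
    replace (a ^ 2 / sin (a * r) ^ 2)
      with (a ^ 2 * (sin (a * r) ^ 2 + cos (a * r) ^ 2) / sin (a * r) ^ 2)
      by (rewrite sin2_cos2_pow, Rmult_1_r; trivial).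
    field. lra. }
intros r t hr. assert (hs := polar_interval_sin_pos r hr).
unfold codiff2. rewrite (polar_star1 _ _ hdW) by trivial.
destruct i; field; lra.
Qed.

Lemma laminar_hodge_laplacian (i : coord) (r t : R) : I r ->
  hodge_laplacian g (flat g u) i r t = codiff2 g (d1 (flat g u)) i r t.
Proof.
intros hr. unfold hodge_laplacian.
rewrite (radial_d0 _ _ (fun _ => 0) laminar_codiff1); trivial.
- destruct i; ring.
- intros x _. apply (is_derive_const (K := R_AbsRing) (V := R_NormedModule)).
Qed.

Lemma laminar_ricci1 (i : coord) (r t : R) : I r ->
  ricci1 g (flat g u) i r t = a ^ 2 * flat g u i r t.
Proof.
intros hr. assert (hs := polar_interval_sin_pos r hr).
unfold ricci1, sharp, sumc.
rewrite !polar_ricci, !polar_ginv, !laminar_flat, !hg by trivial.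
destruct i; field; lra.
Qed.

(** Particles run at constant speed [|Y r|] on circles of geodesic curvature [a cos / sin]; the term
    is their centripetal acceleration, hence purely radial. *)
Lemma laminar_convection (i : coord) : radial_on I (flat g (covd g u u) i)
  (fun r => match i with
            | Cr => - (a * cos (a * r) / sin (a * r) * Y r ^ 2)
            | Ct => 0
            end).
Proof.
intros r t hr. assert (hs := polar_interval_sin_pos r hr).
(* Only derivatives along the flow count: those in [r] are multiplied by the vanishing radial
   component of [u]. *)
assert (hu : forall i, partial Ct (u i) r t = 0).
{ intros k. apply (radial_partial_t I _
    (fun x => match k with Cr => 0 | Ct => - Y x * (a / sin (a * x)) end)); trivial.
  intros x y _. now destruct k. }
unfold flat, covd, sumc. rewrite !hu, !polar_christoffel, !hg by trivial.
unfold u, laminar_flow. destruct i; field; lra.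
Qed.

(** Coriolis and convection terms are radial, the viscous term is angular, so the two components
    decouple. The Ricci term contributes [2 * a ^ 2 * sin]. *)
Lemma laminar_momentum (nu beta : R) (P : scalar) (i : coord) (r t : R) : I r ->
  momentum a nu beta g u P i r t =
  match i with
  | Cr => beta * cos (a * r) * Y r - a * cos (a * r) / sin (a * r) * Y r ^ 2
          + partial Cr P r t
  | Ct => nu / a * (sin (a * r) * Y2 r + a * cos (a * r) * Y1 r
                    + (2 * a ^ 2 * sin (a * r) - a ^ 2 / sin (a * r)) * Y r)
          + partial Ct P r t
  end.
Proof.
intros hr. assert (hs := polar_interval_sin_pos r hr).
unfold momentum.
rewrite laminar_hodge_laplacian, laminar_ricci1, laminar_codiff2, laminar_convection,
  (polar_star1 _ _ laminar_flat), laminar_flat by trivial.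
unfold d0. destruct i; field; lra.
Qed.

End LaminarFlow.

End PolarCalculus.

(** * Real-analytic functions *)

(** The expansion is two-sided, unlike in [real_analytic_on]; this form yields ordinary derivatives
    at [delta] as well. *)
Definition analytic_at (f : R -> R) (x0 : R) : Prop :=
  exists (c : nat -> R) (rho : posreal),
    forall h, Rabs h < rho -> is_pseries c h (f (x0 + h)).

(** Were the radius at most [|h|], the terms at a point halfway between [|h|] and [rho] would not
    tend to 0, although the series converges there. *)
Lemma CV_radius_gt (c : nat -> R) (rho h : R) :
  (forall x, Rabs x < rho -> ex_pseries c x) -> Rabs h < rho ->
  Rbar_lt (Rabs h) (CV_radius c).
Proof.
intros hc hh. apply Rbar_not_le_lt. intros hle.
set (y := (Rabs h + rho) / 2).
assert (hy : Rabs y = y) by (apply Rabs_pos_eq; assert (H := Rabs_pos h); unfold y; lra).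
assert (hy1 : Rabs h < y < rho) by (unfold y; lra).
apply (CV_disk_outside c y).
- rewrite hy. apply Rbar_le_lt_trans with (1 := hle). simpl. lra.
- destruct (hc y) as [l hl]; [lra|].
  apply is_lim_seq_ext with (fun n => scal (pow_n y n) (c n)).
  + intros n. unfold scal; simpl. unfold mult; simpl. rewrite pow_n_pow. ring.
  + apply ex_series_lim_0. now exists l.
Qed.

Lemma analytic_ext_loc (f g : R -> R) (x0 : R) :
  locally x0 (fun x => f x = g x) -> analytic_at f x0 -> analytic_at g x0.
Proof.
intros [eps he] (c & rho & hc).
exists c, (mkposreal _ (Rmin_stable_in_posreal rho eps)). simpl. intros h hh.
assert (h1 := Rmin_l rho eps). assert (h2 := Rmin_r rho eps).
rewrite <- he; [apply hc; lra|].
unfold ball; simpl. unfold AbsRing_ball, abs, minus, plus, opp; simpl.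
replace (x0 + h + - x0) with h by ring. lra.
Qed.

Lemma is_pseries_const (k h : R) :
  is_pseries (fun n => match n with O => k | S _ => 0 end) h k.
Proof.
apply is_series_Reals. intros eps heps. exists O. intros n _.
replace (sum_f_R0 _ n) with k; [now rewrite Rdist_eq|].
induction n as [|n IH].
- simpl. unfold scal; simpl. unfold mult; simpl. unfold one; simpl. ring.
- rewrite tech5, <- IH. unfold scal; simpl. unfold mult; simpl. ring.
Qed.

Lemma analytic_const (k x0 : R) : analytic_at (fun _ => k) x0.
Proof.
exists (fun n => match n with O => k | S _ => 0 end), (mkposreal 1 Rlt_0_1).
intros h _. apply is_pseries_const.
Qed.

Lemma analytic_plus (f g : R -> R) (x0 : R) :
  analytic_at f x0 -> analytic_at g x0 -> analytic_at (fun x => f x + g x) x0.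
Proof.
intros (c & rho & hc) (d & sig & hd).
exists (PS_plus c d), (mkposreal _ (Rmin_stable_in_posreal rho sig)).
simpl. intros h hh.
assert (h1 := Rmin_l rho sig). assert (h2 := Rmin_r rho sig).
apply (is_pseries_plus (K := R_AbsRing) (V := R_NormedModule)); [apply hc|apply hd]; lra.
Qed.

Lemma analytic_mult (f g : R -> R) (x0 : R) :
  analytic_at f x0 -> analytic_at g x0 -> analytic_at (fun x => f x * g x) x0.
Proof.
intros (c & rho & hc) (d & sig & hd).
exists (PS_mult c d), (mkposreal _ (Rmin_stable_in_posreal rho sig)).
simpl. intros h hh.
assert (h1 := Rmin_l rho sig). assert (h2 := Rmin_r rho sig).
apply is_pseries_mult.
- apply hc; lra.
- apply hd; lra.
- apply CV_radius_gt with rho; [|lra]. intros x hx. eexists. now apply hc.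
- apply CV_radius_gt with sig; [|lra]. intros x hx. eexists. now apply hd.
Qed.

(** The series of [g] is integrated term by term. [PS_Int] has constant term 0, so the value [f x0]
    is split off first. *)
Lemma analytic_antiderivative (f g : R -> R) (x0 : R) :
  locally x0 (fun x => is_derive f x (g x)) -> analytic_at g x0 -> analytic_at f x0.
Proof.
intros [eps he] (c & rho & hc).
assert (hr : forall x, Rabs x < rho -> Rbar_lt (Rabs x) (CV_radius c)).
{ intros x hx. apply CV_radius_gt with rho; trivial. intros y hy. eexists. now apply hc. }
apply analytic_ext_loc with (fun x => f x0 + (f x - f x0)).
{ apply filter_forall. intros x. ring. }
apply (analytic_plus (fun _ => f x0) (fun x => f x - f x0)).
{ apply analytic_const. }
exists (PS_Int c), (mkposreal _ (Rmin_stable_in_posreal rho eps)). simpl. intros h hh.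
assert (h1 := Rmin_l rho eps). assert (h2 := Rmin_r rho eps).
replace (f (x0 + h) - f x0) with (RInt (PSeries c) 0 h).
{ apply is_pseries_RInt, hr. lra. }
apply is_RInt_unique.
assert (hb : forall x, Rmin 0 h <= x <= Rmax 0 h -> Rabs x <= Rabs h).
{ intros x. unfold Rmin, Rmax. destruct (Rle_dec 0 h); unfold Rabs;
  destruct (Rcase_abs x), (Rcase_abs h); lra. }
evar_last.
- apply (is_RInt_derive (fun x => f (x0 + x)) (PSeries c)).
  + intros x hx. apply hb in hx.
    rewrite (is_pseries_unique c x (g (x0 + x))) by (apply hc; lra).
    evar_last.
    * apply (is_derive_comp f (fun y => x0 + y)).
      -- apply he. unfold ball; simpl. unfold AbsRing_ball, abs, minus, plus, opp; simpl.
         replace (x0 + x + - x0) with x by ring. lra.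
      -- auto_derive; trivial.
    * unfold scal; simpl. unfold mult; simpl. ring.
  + intros x hx. apply hb in hx.
    apply (ex_derive_continuous (V := R_NormedModule)). eexists.
    apply is_derive_PSeries, hr. lra.
- change (f (x0 + h) - f (x0 + 0) = f (x0 + h) - f x0). now rewrite Rplus_0_r.
Qed.

(** * Power series of sine and cosine *)

Lemma pseries_sqr_coef (c : nat -> R) (x l : R) :
  infinite_sum (fun i => c i * (Rsqr x) ^ i) l -> is_pseries c (x ^ 2) l.
Proof.
intros H. apply is_series_Reals in H. unfold is_pseries.
apply is_series_ext with (2 := H). intros n.
rewrite Rsqr_pow2. apply Rmult_comm.
Qed.

Lemma is_pseries_zero (x : R) : is_pseries (fun _ => 0) x 0.
Proof.
apply is_pseries_ext with (2 := is_pseries_const 0 x). now intros [|n].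
Qed.

Lemma is_pseries_cos (x : R) :
  is_pseries (fun n => if Nat.even n then cos_n (Nat.div2 n) else 0) x (cos x).
Proof.
(* [cos] is defined as a series in [Rsqr x]; the added [x * 0] is the odd part expected by
   [is_pseries_odd_even]. *)
replace (cos x) with (cos x + x * 0) by ring.
apply is_pseries_odd_even.
- apply is_pseries_ext with cos_n.
  + intros n. now rewrite Nat.even_mul, Nat.div2_double.
  + apply pseries_sqr_coef. unfold cos. now destruct (exist_cos (Rsqr x)).
- apply is_pseries_ext with (fun _ => 0); [|apply is_pseries_zero].
  intros n. now rewrite Nat.even_add, Nat.even_mul.
Qed.

Lemma is_pseries_sin (x : R) :
  is_pseries (fun n => if Nat.even n then 0 else sin_n (Nat.div2 n)) x (sin x).
Proof.
unfold sin. destruct (exist_sin (Rsqr x)) as [l hl].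
replace (x * l) with (0 + x * l) by ring.
apply is_pseries_odd_even.
- apply is_pseries_ext with (fun _ => 0); [|apply is_pseries_zero].
  intros n. now rewrite Nat.even_mul.
- apply is_pseries_ext with sin_n; [|now apply pseries_sqr_coef].
  intros n. rewrite Nat.even_add, Nat.even_mul, Nat.add_1_r. simpl Nat.even.
  now rewrite Nat.div2_succ_double.
Qed.

Lemma is_pseries_scale (c : nat -> R) (a h l : R) :
  is_pseries c (a * h) l -> is_pseries (fun n => a ^ n * c n) h l.
Proof.
apply is_series_ext. intros n.
change ((a * h) ^ n * c n = h ^ n * (a ^ n * c n)). rewrite Rpow_mult_distr. ring.
Qed.

(** The addition formulas carry the expansion at 0 to [x0]. Both series converge everywhere, and the
    radius 1 is an arbitrary choice. *)
Lemma analytic_sin_cos_scale (a x0 : R) :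
  analytic_at (fun x => sin (a * x)) x0 /\ analytic_at (fun x => cos (a * x)) x0.
Proof.
set (C := fun n => a ^ n * (if Nat.even n then cos_n (Nat.div2 n) else 0)).
set (S := fun n => a ^ n * (if Nat.even n then 0 else sin_n (Nat.div2 n))).
split.
- exists (PS_plus (PS_scal (sin (a * x0)) C) (PS_scal (cos (a * x0)) S)),
    (mkposreal 1 Rlt_0_1).
  intros h _. rewrite Rmult_plus_distr_l, sin_plus.
  apply (is_pseries_plus (K := R_AbsRing) (V := R_NormedModule));
  apply (is_pseries_scal (K := R_AbsRing) (V := R_NormedModule));
    try apply Rmult_comm; apply is_pseries_scale;
    [apply is_pseries_cos|apply is_pseries_sin].
- exists (PS_plus (PS_scal (cos (a * x0)) C) (PS_scal (- sin (a * x0)) S)),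
    (mkposreal 1 Rlt_0_1).
  intros h _. rewrite Rmult_plus_distr_l, cos_plus.
  replace (_ - _) with (cos (a * x0) * cos (a * h) + (- sin (a * x0)) * sin (a * h))
    by ring.
  apply (is_pseries_plus (K := R_AbsRing) (V := R_NormedModule));
  apply (is_pseries_scal (K := R_AbsRing) (V := R_NormedModule));
    try apply Rmult_comm; apply is_pseries_scale;
    [apply is_pseries_cos|apply is_pseries_sin].
Qed.

(** * The reciprocal of a power series *)

(** [recip_prefix c n] agrees with the reciprocal series of [c] up to index [n]. *)
Fixpoint recip_prefix (c : nat -> R) (n : nat) : nat -> R :=
  match n with
  | O => fun _ => / c O
  | S m => fun k =>
      if Nat.leb k m then recip_prefix c m k
      else - / c O * sum_f_R0 (fun i => c (S i) * recip_prefix c m (m - i)%nat) m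
  end.

Definition recip_coef (c : nat -> R) (n : nat) : R := recip_prefix c n n.

Lemma recip_prefix_coef (c : nat -> R) (n k : nat) :
  (k <= n)%nat -> recip_prefix c n k = recip_coef c k.
Proof.
induction n as [|n IH]; intros hk.
- now replace k with O by (symmetry; apply Nat.le_0_r; trivial).
- apply Nat.le_succ_r in hk. destruct hk as [hk| ->]; trivial.
  simpl. rewrite (proj2 (Nat.leb_le k n) hk). now apply IH.
Qed.

(** The Cauchy product with [c] has to vanish in degree [S n]; solving for the newest coefficient
    gives this recursion on all the earlier ones. *)
Lemma recip_coef_S (c : nat -> R) (n : nat) :
  recip_coef c (S n) = - / c O * sum_f_R0 (fun i => c (S i) * recip_coef c (n - i)) n.
Proof.
unfold recip_coef at 1. cbn [recip_prefix].
rewrite (proj2 (Nat.leb_gt (S n) n) (Nat.lt_succ_diag_r n)). f_equal.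
apply sum_eq. intros i hi. f_equal. apply recip_prefix_coef, Nat.le_sub_l.
Qed.

Lemma PS_mult_recip (c : nat -> R) (n : nat) : c O <> 0 ->
  PS_mult c (recip_coef c) n = match n with O => 1 | S _ => 0 end.
Proof.
intros hc. unfold PS_mult. destruct n as [|n].
- simpl. unfold recip_coef. simpl. now field.
- rewrite decomp_sum by apply Nat.lt_0_succ. simpl Nat.pred.
  rewrite Nat.sub_0_r, recip_coef_S.
  cbn [Nat.sub].
  field. trivial.
Qed.

Lemma geometric_tail_bound (t : R) (n : nat) :
  0 < t < 1 -> sum_f_R0 (fun i => t ^ S i) n <= t / (1 - t).
Proof.
intros ht.
rewrite (sum_eq _ (fun i => t ^ i * t)) by (intros; simpl; ring).
rewrite <- scal_sum, tech3 by lra.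
unfold Rdiv. apply Rmult_le_compat_l; [lra|].
assert (0 < / (1 - t)) by (apply Rinv_0_lt_compat; lra).
assert (0 < t ^ S n) by (apply pow_lt; lra).
nra.
Qed.

(** With [k0 = |c 0|] and [t = k0 / (k0 + M)], the recursion multiplies the bound by at most [(M /
    k0) * (t + t^2 + ...) <= (M / k0) * t / (1 - t)]. The choice of [t] makes the last product 1, so
    the bound [/ k0] propagates. *)
Lemma recip_coef_bound (c : nat -> R) (y M : R) (n : nat) :
  c O <> 0 -> 0 < y -> 0 < M -> (forall k, Rabs (c k * y ^ k) <= M) ->
  Rabs (recip_coef c n * (y * (Rabs (c O) / (Rabs (c O) + M))) ^ n) <= / Rabs (c O).
Proof.
intros hc hy hM hb.
assert (hc0 := Rabs_pos_lt _ hc).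
set (k0 := Rabs (c O)) in *. set (t := k0 / (k0 + M)).
assert (ht0 : 0 < t) by (apply Rdiv_lt_0_compat; lra).
assert (ht : t < 1) by (apply Rlt_div_l; lra).
assert (htt : t / (1 - t) = k0 / M) by (unfold t; field; split; lra).
assert (hi := Rinv_0_lt_compat _ hc0).
induction n as [n IH] using (well_founded_induction Wf_nat.lt_wf).
destruct n as [|n].
- simpl. unfold recip_coef. simpl. rewrite Rmult_1_r, Rabs_inv. apply Rle_refl.
- rewrite recip_coef_S.
  replace (- / c O * sum_f_R0 (fun i => c (S i) * recip_coef c (n - i)) n * (y * t) ^ S n)
    with (- / c O * sum_f_R0 (fun i =>
       (c (S i) * y ^ S i) * t ^ S i * (recip_coef c (n - i) * (y * t) ^ (n - i))) n).
  2:{ rewrite Rmult_assoc, (Rmult_comm (sum_f_R0 _ _)), !scal_sum.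
      apply sum_eq. intros i hle.
      replace (S n) with (S i + (n - i))%nat
        by (simpl; f_equal; rewrite Nat.add_comm; now apply Nat.sub_add).
      rewrite pow_add, (Rpow_mult_distr y t (S i)). ring. }
  rewrite Rabs_mult, Rabs_Ropp, Rabs_inv. fold k0.
  rewrite <- (Rmult_1_r (/ k0)) at 2. apply Rmult_le_compat_l; [lra|].
  eapply Rle_trans; [apply Rsum_abs|].
  apply Rle_trans with (sum_f_R0 (fun i => t ^ S i * (M * / k0)) n).
  + apply sum_Rle. intros i hle. rewrite !Rabs_mult, (Rabs_pos_eq (t ^ S i)).
    2:{ apply pow_le. lra. }
    rewrite <- !Rabs_mult.
    replace (t ^ S i * (M * / k0)) with (M * t ^ S i * / k0) by ring.
    assert (0 < t ^ S i) by (apply pow_lt; lra).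
    apply Rmult_le_compat.
    * apply Rmult_le_pos; [apply Rabs_pos|lra].
    * apply Rabs_pos.
    * apply Rmult_le_compat_r; [lra|apply hb].
    * apply IH. apply Nat.lt_succ_r, Nat.le_sub_l.
  + rewrite <- scal_sum.
    apply Rle_trans with (M * / k0 * (t / (1 - t))).
    * apply Rmult_le_compat_l; [apply Rmult_le_pos; lra|].
      apply geometric_tail_bound. lra.
    * rewrite htt. right. field. split; lra.
Qed.

Lemma pseries_coef_bounded (c : nat -> R) (y : R) :
  ex_pseries c y -> exists M, 0 < M /\ forall n, Rabs (c n * y ^ n) <= M.
Proof.
intros hy.
assert (L : is_lim_seq (fun n => c n * y ^ n) 0).
{ apply is_lim_seq_ext with (fun n => scal (pow_n y n) (c n)).
  - intros n. unfold scal; simpl. unfold mult; simpl. rewrite pow_n_pow. ring.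
  - now apply ex_series_lim_0. }
destruct (filterlim_bounded (K := R_AbsRing) (V := R_NormedModule)
  (fun n => c n * y ^ n)) as [M hM].
- exists 0. exact L.
- exists (M + 1). split.
  + assert (H := hM O). assert (H1 := norm_ge_0 (c O * y ^ 0)). lra.
  + intros n. apply Rle_trans with M; [apply hM|lra].
Qed.

Lemma analytic_inv (f : R -> R) (x0 : R) :
  f x0 <> 0 -> analytic_at f x0 -> analytic_at (fun x => / f x) x0.
Proof.
intros hf (c & rho & hc). assert (hrho := cond_pos rho).
assert (E0 : c O = f x0).
{ assert (H : is_pseries c 0 (f (x0 + 0))) by (apply hc; rewrite Rabs_R0; lra).
  rewrite Rplus_0_r in H. apply is_pseries_unique in H.
  now rewrite PSeries_0 in H. }
rewrite <- E0 in hf.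
set (y := rho / 2). assert (hy : 0 < y) by (unfold y; lra).
destruct (pseries_coef_bounded c y) as (M & hM & hb).
{ eexists. apply hc. rewrite Rabs_pos_eq; unfold y; lra. }
set (t := Rabs (c O) / (Rabs (c O) + M)).
assert (hk := Rabs_pos_lt _ hf).
assert (ht0 : 0 < t) by (apply Rdiv_lt_0_compat; lra).
assert (ht : t < 1) by (apply Rlt_div_l; lra).
assert (hq : 0 < y * t) by nra.
assert (hq1 : y * t < rho) by (unfold y in *; nra).
assert (hR : Rbar_le (y * t) (CV_radius (recip_coef c))).
{ apply (proj1 (CV_radius_bounded (recip_coef c))). exists (/ Rabs (c O)).
  intros n. now apply recip_coef_bound. }
exists (recip_coef c), (mkposreal _ hq). simpl. intros h hh.
assert (R1 : Rbar_lt (Rabs h) (CV_radius c)).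
{ apply CV_radius_gt with rho; [|lra]. intros x hx. eexists. now apply hc. }
assert (R2 : Rbar_lt (Rabs h) (CV_radius (recip_coef c))).
{ apply Rbar_lt_le_trans with (2 := hR). exact hh. }
assert (P := PSeries_mult c (recip_coef c) h R1 R2).
rewrite (is_pseries_unique c h _ (hc h ltac:(lra))) in P.
assert (E : PSeries (PS_mult c (recip_coef c)) h = 1).
{ rewrite (PSeries_ext _ (fun n => match n with O => 1 | S _ => 0 end))
    by (intros n; now apply PS_mult_recip).
  apply is_pseries_unique, is_pseries_const. }
rewrite E in P.
replace (/ f (x0 + h)) with (PSeries (recip_coef c) h).
- apply PSeries_correct. now apply CV_radius_inside.
(* The product of the two sums being 1 also shows that [f] has no zero on this disc. *)
- assert (f (x0 + h) <> 0) by (intros Z; rewrite Z in P; lra).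
  apply (Rmult_eq_reg_l (f (x0 + h))); trivial. rewrite <- P. now field.
Qed.

Lemma analytic_ex_derive_n (f : R -> R) (x : R) (n : nat) :
  analytic_at f x -> ex_derive_n f n x.
Proof.
intros (c & rho & hc).
apply ex_derive_n_ext_loc with (fun y => PSeries c (y + - x)).
- exists rho. intros y hy.
  unfold ball in hy; simpl in hy. unfold AbsRing_ball, abs, minus, plus, opp in hy; simpl in hy.
  apply is_pseries_unique.
  replace (f y) with (f (x + (y + - x))) by (f_equal; ring). now apply hc.
- apply ex_derive_n_comp_trans, ex_derive_n_PSeries.
  apply CV_radius_gt with rho.
  + intros y hy. eexists. now apply hc.
  + rewrite Rplus_opp_r, Rabs_R0. apply cond_pos.
Qed.

(** * Derivatives relative to the profile interval *)

(** Approach from the right is possible at every point, [delta] included; this makes limits and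
    derivatives relative to the interval unique. *)
Lemma profile_interval_limit_point (a delta x : R) :
  profile_interval a delta x -> adhDa (D_x (profile_interval a delta) x) x.
Proof.
intros [h1 h2] alp halp.
set (m := Rmin (alp / 2) ((PI / a - x) / 2)).
assert (m1 := Rmin_l (alp / 2) ((PI / a - x) / 2)).
assert (m2 := Rmin_r (alp / 2) ((PI / a - x) / 2)).
assert (m0 : 0 < m) by (apply Rmin_pos; lra). fold m in m1, m2.
exists (x + m). split.
- split; [split|]; lra.
- unfold Rdist. replace (x + m - x) with m by ring. rewrite Rabs_pos_eq; lra.
Qed.

Lemma D_in_ext_on (I : R -> Prop) (x : R) (h h' f : R -> R) :
  I x -> (forall y, I y -> h y = h' y) -> D_in h f I x -> D_in h' f I x.
Proof.
intros hx E hf eps heps. destruct (hf eps heps) as (alp & halp & H).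
exists alp. split; trivial. intros y hy.
rewrite <- !E by (trivial; apply hy). now apply H.
Qed.

Lemma D_in_unique (a delta x : R) (h h' f f' : R -> R) :
  let I := profile_interval a delta in
  I x -> (forall y, I y -> h y = h' y) -> D_in h f I x -> D_in h' f' I x -> f x = f' x.
Proof.
intros I hx E hf hf'.
apply (single_limit (fun y => (h' y - h' x) / (y - x)) (D_x I x) _ _ x); trivial.
- now apply profile_interval_limit_point.
- now apply D_in_ext_on with h.
Qed.

(** Smoothness and the two prescribed derivatives each come with their own witnesses; this
    identifies them on the interval. *)
Lemma is_nth_derivative_on_unique (a delta : R) (n : nat) (f fn fn' : R -> R) :
  let I := profile_interval a delta in
  is_nth_derivative_on n I f fn -> is_nth_derivative_on n I f fn' ->
  forall x, I x -> fn x = fn' x.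
Proof.
intros I. revert fn fn'.
induction n as [|n IH]; simpl; intros fn fn'.
- intros h h' x hx. now rewrite h, h'.
- intros (h & hn & hd) (h' & hn' & hd') x hx.
  apply (D_in_unique a delta x h h'); auto.
Qed.

Lemma D_in_is_derive (a delta x : R) (f df : R -> R) :
  delta < x < PI / a -> D_in f df (profile_interval a delta) x -> is_derive f x (df x).
Proof.
intros hx H. apply is_derive_Reals. intros eps heps.
destruct (H eps heps) as (alp & halp & hl). simpl in hl.
assert (m1 := Rmin_l alp (Rmin (x - delta) (PI / a - x))).
assert (m2 := Rmin_r alp (Rmin (x - delta) (PI / a - x))).
assert (m3 := Rmin_l (x - delta) (PI / a - x)).
assert (m4 := Rmin_r (x - delta) (PI / a - x)).
set (m := Rmin alp (Rmin (x - delta) (PI / a - x))) in *.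
assert (m0 : 0 < m) by (repeat apply Rmin_pos; lra).
exists (mkposreal m m0). simpl. intros h hh hm.
apply Rabs_def2 in hm.
replace h with (x + h - x) at 2 by ring. apply hl. split.
- split; [split|]; lra.
- unfold Rdist. replace (x + h - x) with h by ring. apply Rabs_def1; lra.
Qed.

Lemma is_derive_D_in (D : R -> Prop) (x : R) (f df : R -> R) :
  is_derive f x (df x) -> D_in f df D x.
Proof.
intros H. apply is_derive_Reals in H. intros eps heps.
destruct (H eps heps) as (alp & hl). exists alp. split; [apply cond_pos|].
simpl. intros y [[_ hy] hd]. unfold Rdist in *.
assert (hyx : y - x <> 0) by lra. specialize (hl (y - x) hyx hd).
now replace (x + (y - x)) with y in hl by ring.
Qed.

Lemma ex_derive_continue_in (D : R -> Prop) (x : R) (f : R -> R) :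
  ex_derive f x -> continue_in f D x.
Proof. intros [l hl]. apply (cont_deriv f (fun _ => l)). now apply is_derive_D_in. Qed.

(** Carries initial data into the interior: a conserved quantity of the open interval takes its
    limit at [delta]. *)
Lemma const_eq_right_limit (a delta L : R) (f : R -> R) :
  delta < PI / a ->
  (forall x y, delta < x < PI / a -> delta < y < PI / a -> f x = f y) ->
  limit1_in f (D_x (profile_interval a delta) delta) L delta ->
  forall x, delta < x < PI / a -> f x = L.
Proof.
intros hd hf hl x hx.
apply (single_limit f (fun y => delta < y < PI / a) _ _ delta).
- intros alp halp.
  destruct (profile_interval_limit_point a delta delta) with alp
    as (y & [[hy1 hy2] hy3] & hy4); trivial.
  + split; lra.
  + exists y. split; trivial. split; lra.
- intros eps heps. exists 1. split; [lra|]. simpl. intros y [hy _].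
  rewrite (hf y x hy hx). now rewrite Rdist_eq.
- intros eps heps. destruct (hl eps heps) as (alp & halp & H).
  exists alp. split; trivial. intros y [hy hyd]. apply H.
  split; trivial. split; [split|]; lra.
Qed.

Lemma is_derive_zero_const (lo hi : R) (f : R -> R) :
  (forall x, lo < x < hi -> is_derive f x 0) ->
  forall x y, lo < x < hi -> lo < y < hi -> f x = f y.
Proof.
intros hf x y hx hy.
destruct (Rtotal_order x y) as [h|[->|h]]; trivial; [|symmetry];
  apply (eq_is_derive (V := R_NormedModule)); trivial; intros t ht; apply hf; lra.
Qed.

Lemma analytic_nth_derivative_on (I : R -> Prop) (f : R -> R) (n : nat) :
  (forall x, I x -> analytic_at f x) -> is_nth_derivative_on n I f (Derive_n f n).
Proof.
intros hf. induction n as [|n IH]; [now intros x _|].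
exists (Derive_n f n). split; trivial.
intros x hx. apply is_derive_D_in. apply Derive_correct.
apply (analytic_ex_derive_n f x (S n)). now apply hf.
Qed.

Lemma analytic_at_real_analytic_on (I : R -> Prop) (f : R -> R) :
  (forall x, I x -> analytic_at f x) -> real_analytic_on I f.
Proof.
intros hf x0 hx0. destruct (hf x0 hx0) as (c & rho & hc). exists c, rho.
intros x _ hx. replace (f x) with (f (x0 + (x - x0))) by (f_equal; ring). now apply hc.
Qed.

Lemma analytic_antiderivative_exists (lo hi x0 : R) (g : R -> R) :
  lo < x0 < hi -> (forall x, lo < x < hi -> analytic_at g x) ->
  exists G, G x0 = 0 /\ (forall x, lo < x < hi -> is_derive G x (g x)) /\
    (forall x, lo < x < hi -> analytic_at G x).
Proof.
intros hx0 hg.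
assert (cg : forall x, lo < x < hi -> continuous g x).
{ intros x hx. apply (ex_derive_continuous (V := R_NormedModule)).
  apply (analytic_ex_derive_n g x 1). now apply hg. }
assert (hI : forall x, lo < x < hi -> is_RInt g x0 x (RInt g x0 x)).
{ intros x hx. apply (RInt_correct (V := R_CompleteNormedModule)).
  apply (ex_RInt_continuous (V := R_CompleteNormedModule)).
  intros z hz. apply cg. unfold Rmin, Rmax in hz. destruct (Rle_dec x0 x); lra. }
assert (hloc : forall (P : R -> Prop) x, lo < x < hi ->
  (forall y, lo < y < hi -> P y) -> locally x P).
{ intros P x hx hP. apply (locally_interval _ x lo hi); simpl; try apply hx.
  intros y h1 h2. apply hP. lra. }
assert (hD : forall x, lo < x < hi -> is_derive (fun y => RInt g x0 y) x (g x)).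
{ intros x hx. apply (is_derive_RInt (V := R_NormedModule) g _ x0); auto. }
exists (fun x => RInt g x0 x). split; [|split]; trivial.
- apply (RInt_point (V := R_CompleteNormedModule)).
- intros x hx. apply analytic_antiderivative with g; auto.
Qed.

(** The pressure has this form, and the form is stable under both partial derivatives: they give
    [Derive G r + 0 * t] and [k + 0 * t]. Hence the induction over all [f], [G] and [k]. *)
Lemma Ck2_on_radial_plus_linear (lo hi tau : R) (n : nat) :
  let D := fun r t => lo < r < hi /\ 0 < t < tau in
  forall (f : scalar) (G : R -> R) (k : R),
  (forall r t, D r t -> f r t = G r + k * t) ->
  (forall m r, lo < r < hi -> ex_derive_n G m r) ->
  Ck2_on n D f.
Proof.
intros D. induction n as [|n IH]; intros f G k hf hG.
- intros r t [hr ht].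
  apply continuity_2d_pt_ext_loc with (fun x y => G x + k * y).
  + assert (L1 : locally r (fun x => lo < x < hi)).
    { apply (locally_interval _ r lo hi); simpl; try apply hr. auto. }
    assert (L2 : locally t (fun y => 0 < y < tau)).
    { apply (locally_interval _ t 0 tau); simpl; try apply ht. auto. }
    destruct L1 as [e1 h1], L2 as [e2 h2].
    exists (mkposreal _ (Rmin_stable_in_posreal e1 e2)). simpl. intros x y hx hy.
    assert (m1 := Rmin_l e1 e2). assert (m2 := Rmin_r e1 e2).
    symmetry. apply hf. split; [apply h1|apply h2]; unfold ball; simpl;
      unfold AbsRing_ball, abs, minus, plus, opp; simpl; unfold Rminus in *; lra.
  + apply continuity_2d_pt_plus.
    * apply (continuity_1d_2d_pt_comp G (fun u _ => u)); [|apply continuity_2d_pt_id1].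
      apply continuity_pt_filterlim. apply (ex_derive_continuous (V := R_NormedModule)).
      now apply (hG 1%nat).
    * apply continuity_2d_pt_mult; [apply continuity_2d_pt_const|apply continuity_2d_pt_id2].
- assert (dr : forall r t, D r t -> is_derive (fun x => f x t) r (Derive G r)).
  { intros r t [hr ht]. apply is_derive_ext_loc with (fun x => G x + k * t).
    - apply (locally_interval _ r lo hi); simpl; try apply hr.
      intros y h1 h2. symmetry. apply hf. now split.
    - assert (hd : ex_derive G r) by now apply (hG 1%nat).
      auto_derive; [trivial|]. change (1 * Derive G r = Derive G r). ring. }
  assert (dt : forall r t, D r t -> is_derive (fun y => f r y) t k).
  { intros r t [hr ht]. apply is_derive_ext_loc with (fun y => G r + k * y).
    - apply (locally_interval _ t 0 tau); simpl; try apply ht.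
      intros y h1 h2. symmetry. apply hf. now split.
    - auto_derive; trivial. ring. }
  split; [|split].
  + intros r t h. split; eexists; [now apply dr|now apply dt].
  + apply (IH _ (Derive G) 0).
    * intros r t h. transitivity (Derive G r); [|ring].
      exact (is_derive_unique _ _ _ (dr r t h)).
    (* Order 0 of [ex_derive_n] is [True]; otherwise one order on [Derive G] is traded for one more
       on [G]. *)
    * intros m r hr. assert (H := hG (S m) r hr). destruct m as [|m]; [exact I|].
      apply (ex_derive_ext (fun x => Derive_n G (S m) x)); [|exact H].
      intros x. rewrite <- Nat.add_1_r. symmetry. apply (Derive_n_comp G m 1).
  + apply (IH _ (fun _ => k) 0).
    * intros r t h. transitivity k; [|ring].
      exact (is_derive_unique _ _ _ (dt r t h)).
    * intros m r hr. apply analytic_ex_derive_n, analytic_const.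
Qed.

(** * The profile equation *)

(** The derivatives are separate arguments, so that the operator can be evaluated at [delta] with
    one-sided ones. *)
Definition profile_operator (a : R) (Y Y1 Y2 : R -> R) (r : R) : R :=
  sin (a * r) * Y2 r + a * cos (a * r) * Y1 r
  + (2 * a ^ 2 * sin (a * r) - a ^ 2 / sin (a * r)) * Y r.

Lemma is_polar_metric_polar (a delta : R) (O e1 e2 : R3) :
  0 < a -> sphere a O -> oriented_tangent_basis O e1 e2 -> 0 < delta ->
  is_polar_metric a delta (polar_metric a O e1 e2).
Proof.
intros ha hO hb hd i j r t hr. apply polar_metric_eq; trivial.
unfold polar_interval in hr. lra.
Qed.

(* Integrating the momentum equation in [t] along two circles and comparing the
   radial equation at two angles shows that the azimuthal force is the same on
   all circles. *)
Lemma profile_operator_const (a nu beta : R) (O e1 e2 : R3) (delta tau : R)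
    (Y Y1 Y2 : R -> R) :
  0 < a -> 0 < nu -> sphere a O -> oriented_tangent_basis O e1 e2 -> 0 < delta ->
  0 < tau < 2 * PI ->
  (forall r, delta < r < PI / a -> is_derive Y r (Y1 r)) ->
  (forall r, delta < r < PI / a -> is_derive Y1 r (Y2 r)) ->
  solves_navier_stokes a nu beta O e1 e2 (exterior_region a O e1 e2 delta tau)
    (laminar_flow a Y) ->
  forall r r', delta < r < PI / a -> delta < r' < PI / a ->
    profile_operator a Y Y1 Y2 r = profile_operator a Y Y1 Y2 r'.
Proof.
intros ha hnu hO hb hd htau hY hY1 (P & hP & hsol).
set (Pc := fun r t => P (polar_chart a O e1 e2 r t)) in *.
assert (hg := is_polar_metric_polar a delta O e1 e2 ha hO hb hd).
set (F := fun r => nu / a * profile_operator a Y Y1 Y2 r).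
set (H := fun r => beta * cos (a * r) * Y r - a * cos (a * r) / sin (a * r) * Y r ^ 2).
assert (hD : forall r t, delta < r < PI / a -> 0 < t < tau ->
  is_derive (fun x => Pc x t) r (- H r) /\ is_derive (fun y => Pc r y) t (- F r)).
{ intros r t hr ht.
  assert (hdom : polar_domain a O e1 e2 (exterior_region a O e1 e2 delta tau) r t).
  { apply polar_domain_exterior; trivial; lra. }
  assert (hdom' := hdom). destruct hdom' as (p & hp & hc).
  destruct (hsol p r t hp hc) as [hm _].
  assert (mr := hm Cr). assert (mt := hm Ct).
  rewrite (laminar_momentum a delta _ ha (Rlt_le _ _ hd) hg Y Y1 Y2 hY hY1) in mr, mt
    by exact hr.
  destruct (hP 1%nat) as [hex _]. destruct (hex r t hdom) as [er et].
  apply Derive_correct in er, et.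
  split.
  - replace (- H r) with (Derive (fun x => Pc x t) r); trivial.
    unfold H. unfold partial in mr. lra.
  - replace (- F r) with (Derive (fun y => Pc r y) t); trivial.
    unfold F, profile_operator. unfold partial in mt. lra. }
(* Comparing pressure differences, instead of equating mixed partials, uses only first derivatives
   of the pressure. *)
assert (hdr : forall r r', delta < r < PI / a -> delta < r' < PI / a ->
  Pc r (tau / 2) - Pc r (tau / 4) = Pc r' (tau / 2) - Pc r' (tau / 4)).
{ apply (is_derive_zero_const delta (PI / a) (fun r => Pc r (tau / 2) - Pc r (tau / 4))).
  intros r hr.
  destruct (hD r (tau / 2) hr) as [d1 _]; [lra|].
  destruct (hD r (tau / 4) hr) as [d2 _]; [lra|].
  evar_last; [apply (is_derive_minus (V := R_NormedModule) _ _ _ _ _ d1 d2)|].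
  unfold minus, plus, opp; simpl. ring. }
assert (hdt : forall r, delta < r < PI / a ->
  Pc r (tau / 2) - Pc r (tau / 4) = - F r * (tau / 4)).
{ intros r hr.
  assert (E : Pc r (tau / 2) + F r * (tau / 2) = Pc r (tau / 4) + F r * (tau / 4)).
  { apply (is_derive_zero_const 0 tau (fun y => Pc r y + F r * y)); try lra.
    intros t ht. destruct (hD r t hr ht) as [_ d].
    evar_last.
    - apply (is_derive_plus (V := R_NormedModule) _ (fun y => F r * y) _ _ (F r) d).
      auto_derive; trivial. ring.
    - unfold plus; simpl. ring. }
  lra. }
intros r r' hr hr'.
assert (E := hdr r r' hr hr'). rewrite !hdt in E by trivial.
assert (EF : F r = F r') by nra.
unfold F in EF. apply Rmult_eq_reg_l in EF; trivial.
apply Rgt_not_eq, Rdiv_lt_0_compat; trivial.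
Qed.

(** The chain is taken up to order three, because differentiability of [Y2] gives its continuity up
    to [delta]. *)
Lemma laminar_profile_derivatives (a nu beta : R) (O e1 e2 : R3)
    (delta tau alpha1 alpha2 : R) (Y : R -> R) :
  delta < PI / a ->
  laminar_profile a nu beta O e1 e2 delta tau alpha1 alpha2 Y ->
  let I := profile_interval a delta in
  exists Y1 Y2 : R -> R,
    (forall x, I x -> D_in Y Y1 I x) /\ (forall x, I x -> D_in Y1 Y2 I x) /\
    (forall x, I x -> continue_in Y2 I x) /\ Y1 delta = alpha1 /\ Y2 delta = - alpha2.
Proof.
intros hd (hs & _ & (f1 & h1 & e1') & (f2 & h2 & e2') & _) I.
assert (hI : I delta) by (split; lra).
destruct (hs 3%nat) as (Y3 & Y2 & hY2 & d3). assert (hY2' := hY2).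
destruct hY2' as (Y1 & hY1 & d2). assert (hY1' := hY1). destruct hY1' as (Y0 & hY0 & d1).
exists Y1, Y2. repeat split; trivial.
- intros x hx. apply D_in_ext_on with Y0; auto.
- intros x hx. apply cont_deriv with Y3. auto.
- rewrite <- e1'. now apply (is_nth_derivative_on_unique a delta 1 Y).
- rewrite <- e2'. now apply (is_nth_derivative_on_unique a delta 2 Y).
Qed.

Lemma continue_in_plus (D : R -> Prop) (x : R) (f g : R -> R) :
  continue_in f D x -> continue_in g D x -> continue_in (fun y => f y + g y) D x.
Proof. apply limit_plus. Qed.

Lemma continue_in_minus (D : R -> Prop) (x : R) (f g : R -> R) :
  continue_in f D x -> continue_in g D x -> continue_in (fun y => f y - g y) D x.
Proof. apply limit_minus. Qed.

Lemma continue_in_mult (D : R -> Prop) (x : R) (f g : R -> R) :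
  continue_in f D x -> continue_in g D x -> continue_in (fun y => f y * g y) D x.
Proof. apply limit_mul. Qed.

(** All terms of the operator are continuous from the right at [delta], so its constant value is
    read off there from the data. *)
Lemma laminar_profile_equation (a nu beta : R) (O e1 e2 : R3)
    (delta tau alpha1 alpha2 : R) (Y : R -> R) :
  0 < a -> 0 < nu -> sphere a O -> oriented_tangent_basis O e1 e2 ->
  0 < delta < PI / a -> 0 < tau < 2 * PI ->
  laminar_profile a nu beta O e1 e2 delta tau alpha1 alpha2 Y ->
  exists Y1 Y2 : R -> R,
    D_in Y Y1 (profile_interval a delta) delta /\
    D_in Y1 Y2 (profile_interval a delta) delta /\
    Y delta = 0 /\ Y1 delta = alpha1 /\
    forall r, delta < r < PI / a ->
      is_derive Y r (Y1 r) /\ is_derive Y1 r (Y2 r) /\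
      profile_operator a Y Y1 Y2 r
      = - alpha2 * sin (a * delta) + a * alpha1 * cos (a * delta).
Proof.
intros ha hnu hO hb hd htau hprof.
destruct (laminar_profile_derivatives _ _ _ _ _ _ _ _ _ _ _ (proj2 hd) hprof)
  as (Y1 & Y2 & d1 & d2 & c2' & i1 & i2).
destruct hprof as (_ & i0 & _ & _ & hsol).
set (I := profile_interval a delta) in *.
assert (hI : I delta) by (split; lra).
assert (hs := sin_pos_radius a delta ha hd).
assert (hY : forall r, delta < r < PI / a -> is_derive Y r (Y1 r)).
{ intros r hr. apply (D_in_is_derive a delta); trivial. apply d1. split; lra. }
assert (hY1 : forall r, delta < r < PI / a -> is_derive Y1 r (Y2 r)).
{ intros r hr. apply (D_in_is_derive a delta); trivial. apply d2. split; lra. }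
exists Y1, Y2. do 4 (split; auto). intros r hr. do 2 (split; auto).
replace (- alpha2 * sin (a * delta) + a * alpha1 * cos (a * delta))
  with (profile_operator a Y Y1 Y2 delta)
  by (unfold profile_operator; rewrite i0, i1, i2; ring).
apply (const_eq_right_limit a delta); trivial; [lra| |].
- apply (profile_operator_const a nu beta O e1 e2 delta tau); trivial; lra.
- apply (continue_in_plus I delta
    (fun r => sin (a * r) * Y2 r + a * cos (a * r) * Y1 r)).
  + apply (continue_in_plus I delta (fun r => sin (a * r) * Y2 r)).
    * apply (continue_in_mult I delta (fun r => sin (a * r))); auto.
      apply ex_derive_continue_in. now auto_derive.
    * apply (continue_in_mult I delta (fun r => a * cos (a * r))).
      -- apply ex_derive_continue_in. now auto_derive.
      -- apply cont_deriv with Y2. auto.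
  + apply (continue_in_mult I delta
      (fun r => 2 * a ^ 2 * sin (a * r) - a ^ 2 / sin (a * r))).
    * apply ex_derive_continue_in. auto_derive. lra.
    * apply cont_deriv with Y1. auto.
Qed.

(* [sin (a r)] solves the homogeneous equation; [N] below is [sin^3] times the
   derivative of [X / sin], as in the reduction of order. *)
Lemma profile_equation_unique (a delta : R) (X X1 X2 : R -> R) :
  0 < a -> 0 < delta < PI / a ->
  continue_in X (profile_interval a delta) delta ->
  continue_in X1 (profile_interval a delta) delta ->
  X delta = 0 -> X1 delta = 0 ->
  (forall r, delta < r < PI / a ->
    is_derive X r (X1 r) /\ is_derive X1 r (X2 r) /\ profile_operator a X X1 X2 r = 0) ->
  forall r, delta < r < PI / a -> X r = 0.
Proof.
intros ha hd cX cX1 i0 i1 hX.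
set (I := profile_interval a delta) in *.
set (N := fun r => sin (a * r) * (sin (a * r) * X1 r - a * cos (a * r) * X r)).
assert (hs : forall r, delta <= r < PI / a -> 0 < sin (a * r)).
{ intros r hr. apply sin_pos_radius; lra. }
assert (hN : forall r, delta < r < PI / a -> N r = N delta).
{ apply const_eq_right_limit; [lra| |].
  - apply is_derive_zero_const. intros r hr.
    destruct (hX r hr) as (d1 & d2 & e). assert (hs' := hs r ltac:(lra)).
    assert (E1 : Derive (fun x : R => X x) r = X1 r) by now apply is_derive_unique.
    assert (E2 : Derive (fun x : R => X1 x) r = X2 r) by now apply is_derive_unique.
    unfold N. auto_derive.
    + repeat split; eexists; eassumption.
    + rewrite E1, E2. unfold profile_operator in e.
      assert (S := sin2_cos2_pow (a * r)).
      (* The integrating factor is [sin]: [N'] equals [sin] times the operator, up to a multiple of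
         [1 - (sin^2 + cos^2)]. *)
      transitivity (sin (a * r) * (sin (a * r) * X2 r + a * cos (a * r) * X1 r
          + (2 * a ^ 2 * sin (a * r) - a ^ 2 / sin (a * r)) * X r)
        + a ^ 2 * X r * (1 - (sin (a * r) ^ 2 + cos (a * r) ^ 2))).
      * field. lra.
      * rewrite e, S. ring.
  - apply (continue_in_mult I delta (fun r => sin (a * r))).
    + apply ex_derive_continue_in. now auto_derive.
    + apply (continue_in_minus I delta (fun r => sin (a * r) * X1 r)).
      * apply (continue_in_mult I delta (fun r => sin (a * r))); trivial.
        apply ex_derive_continue_in. now auto_derive.
      * apply (continue_in_mult I delta (fun r => a * cos (a * r))); trivial.
        apply ex_derive_continue_in. now auto_derive. }
assert (N0 : N delta = 0) by (unfold N; rewrite i0, i1; ring).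
intros r hr. assert (hs' := hs r ltac:(lra)).
assert (E : X r * / sin (a * r) = X delta * / sin (a * delta)).
{ apply (const_eq_right_limit a delta _ (fun x => X x * / sin (a * x))); trivial; [lra| |].
  - apply is_derive_zero_const. intros x hx.
    destruct (hX x hx) as (d1 & _). assert (hsx := hs x ltac:(lra)).
    assert (E1 : Derive (fun y : R => X y) x = X1 x) by now apply is_derive_unique.
    assert (Nx := hN x hx). rewrite N0 in Nx. unfold N in Nx.
    auto_derive.
    + repeat split; [eexists; eassumption|lra].
    + rewrite E1.
      transitivity (sin (a * x) * (sin (a * x) * X1 x - a * cos (a * x) * X x)
        / sin (a * x) ^ 3); [field; lra|].
      rewrite Nx. unfold Rdiv. ring.
  - apply (continue_in_mult I delta X); trivial.
    apply ex_derive_continue_in. auto_derive.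
    assert (H := hs delta ltac:(lra)). lra. }
rewrite i0, Rmult_0_l in E.
apply (Rmult_eq_reg_r (/ sin (a * r))); [|apply Rinv_neq_0_compat; lra].
now rewrite Rmult_0_l.
Qed.

(** The operator is linear and its value is fixed by [alpha1] and [alpha2], so a difference of
    profiles solves the homogeneous equation with zero data. *)
Lemma laminar_profile_unique (a nu beta : R) (O e1 e2 : R3)
    (delta tau alpha1 alpha2 : R) (Y Z : R -> R) :
  0 < a -> 0 < nu -> sphere a O -> oriented_tangent_basis O e1 e2 ->
  0 < delta < PI / a -> 0 < tau < 2 * PI ->
  laminar_profile a nu beta O e1 e2 delta tau alpha1 alpha2 Y ->
  laminar_profile a nu beta O e1 e2 delta tau alpha1 alpha2 Z ->
  forall r, profile_interval a delta r -> Z r = Y r.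
Proof.
intros ha hnu hO hb hd htau hY hZ r [hr1 hr2].
destruct (laminar_profile_equation _ _ _ _ _ _ _ _ _ _ _ ha hnu hO hb hd htau hY)
  as (Y1 & Y2 & dY & dY1 & y0 & y1 & eY).
destruct (laminar_profile_equation _ _ _ _ _ _ _ _ _ _ _ ha hnu hO hb hd htau hZ)
  as (Z1 & Z2 & dZ & dZ1 & z0 & z1 & eZ).
destruct (Req_dec r delta) as [->|hne]; [congruence|].
apply Rminus_diag_uniq.
apply (profile_equation_unique a delta (fun x => Z x - Y x) (fun x => Z1 x - Y1 x)
  (fun x => Z2 x - Y2 x)); trivial; try lra.
- apply continue_in_minus; eapply cont_deriv; eassumption.
- apply continue_in_minus; eapply cont_deriv; eassumption.
- intros x hx. destruct (eY x hx) as (a1 & a2 & a3). destruct (eZ x hx) as (b1 & b2 & b3).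
  split; [|split].
  + now apply (is_derive_minus (V := R_NormedModule)).
  + now apply (is_derive_minus (V := R_NormedModule)).
  + unfold profile_operator in *. lra.
Qed.

(** * Existence *)

Lemma profile_solution_exists (a delta alpha1 alpha2 : R) :
  0 < a -> 0 < delta < PI / a ->
  exists Y Y1 Y2 : R -> R,
    Y delta = 0 /\ Y1 delta = alpha1 /\ Y2 delta = - alpha2 /\
    (forall r, 0 < r < PI / a -> analytic_at Y r /\
      is_derive Y r (Y1 r) /\ is_derive Y1 r (Y2 r) /\
      profile_operator a Y Y1 Y2 r
      = - alpha2 * sin (a * delta) + a * alpha1 * cos (a * delta)).
Proof.
intros ha hd.
assert (hs : forall r, 0 < r < PI / a -> 0 < sin (a * r)).
{ intros r hr. now apply sin_pos_radius. }
assert (hsd := hs delta hd).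
set (C := - alpha2 * sin (a * delta) + a * alpha1 * cos (a * delta)).
(* Chosen so that [W delta = alpha1 / sin (a * delta)]; as [V] vanishes at [delta], the derivative
   of [sin V] there is [alpha1]. *)
set (D := alpha1 * sin (a * delta) ^ 2 + C / a * cos (a * delta)).
set (W := fun r => (D + - (C / a) * cos (a * r))
  * (/ sin (a * r) * (/ sin (a * r) * / sin (a * r)))).
assert (aW : forall r, 0 < r < PI / a -> analytic_at W r).
{ intros r hr. destruct (analytic_sin_cos_scale a r) as [as_ ac].
  assert (hsr := hs r hr).
  assert (ai : analytic_at (fun x => / sin (a * x)) r).
  { apply (analytic_inv (fun x => sin (a * x))); trivial. lra. }
  apply (analytic_mult (fun x => D + - (C / a) * cos (a * x))).
  - apply (analytic_plus (fun _ => D)); [apply analytic_const|].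
    apply (analytic_mult (fun _ => - (C / a))); [apply analytic_const|trivial].
  - apply (analytic_mult (fun x => / sin (a * x))); trivial.
    now apply (analytic_mult (fun x => / sin (a * x))). }
destruct (analytic_antiderivative_exists 0 (PI / a) delta W hd aW) as (V & V0 & dV & aV).
exists (fun r => sin (a * r) * V r).
exists (fun r => a * cos (a * r) * V r + sin (a * r) * W r).
(* The second derivative of [sin V], after substituting [W' = C / sin^2 - 3 a (cos / sin) W]. *)
exists (fun r => - a ^ 2 * sin (a * r) * V r - a * cos (a * r) * W r + C / sin (a * r)).
split; [rewrite V0; ring|split; [|split]].
- rewrite V0. unfold W, D. field. lra.
- rewrite V0. unfold W, D, C. clear - ha hsd. field_simplify_eq; [|lra].
  assert (S := sin2_cos2_pow (a * delta)).
  replace (sin (a * delta) ^ 2) with (1 - cos (a * delta) ^ 2) by lra. ring.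
- intros r hr. assert (hsr := hs r hr). split; [|split; [|split]].
  + apply (analytic_mult (fun x => sin (a * x))); [apply analytic_sin_cos_scale|auto].
  + assert (E : Derive (fun x : R => V x) r = W r) by (apply is_derive_unique; auto).
    auto_derive; [eexists; auto|]. rewrite E. ring.
  + assert (E : Derive (fun x : R => V x) r = W r) by (apply is_derive_unique; auto).
    assert (dVr : ex_derive V r) by (eexists; auto).
    unfold W at 1. auto_derive; [repeat split; trivial; lra|].
    rewrite E. unfold W. field. lra.
  + unfold profile_operator.
    transitivity (C + a ^ 2 * V r * (sin (a * r) ^ 2 + cos (a * r) ^ 2 - 1)).
    * field. lra.
    * rewrite sin2_cos2_pow. ring.
Qed.

Lemma Ck2_on_iff (n : nat) (D D' : R -> R -> Prop) (f : scalar) :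
  (forall r t, D r t <-> D' r t) -> Ck2_on n D f -> Ck2_on n D' f.
Proof.
intros E. revert f. induction n as [|n IH]; simpl; intros f.
- intros h r t hrt. apply h, E, hrt.
- intros (h & hr & ht). split; [intros r t hrt; apply h, E, hrt|auto].
Qed.

(** The pressure must be a function of the point, so it is written with [polar_radius] and
    [polar_angle]; the jump of the angle at [theta = 0] lies outside the sector. *)
Lemma pressure_exists (a nu beta : R) (O e1 e2 : R3) (delta tau c : R)
    (Y Y1 Y2 : R -> R) :
  0 < a -> sphere a O -> oriented_tangent_basis O e1 e2 -> 0 < delta < PI / a ->
  0 < tau < 2 * PI ->
  (forall r, 0 < r < PI / a -> analytic_at Y r /\
    is_derive Y r (Y1 r) /\ is_derive Y1 r (Y2 r) /\ profile_operator a Y Y1 Y2 r = c) ->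
  solves_navier_stokes a nu beta O e1 e2 (exterior_region a O e1 e2 delta tau)
    (laminar_flow a Y).
Proof.
intros ha hO hb hd htau hY.
(* The radial derivative that the momentum equation imposes on the pressure, arranged in products
   for the analyticity lemmas. *)
set (H := fun r => - beta * (cos (a * r) * Y r)
  + a * (cos (a * r) * (/ sin (a * r) * (Y r * Y r)))).
assert (aH : forall r, 0 < r < PI / a -> analytic_at H r).
{ intros r hr. destruct (analytic_sin_cos_scale a r) as [as_ ac].
  destruct (hY r hr) as [aY _]. assert (hs := sin_pos_radius a r ha hr).
  apply (analytic_plus (fun x => - beta * (cos (a * x) * Y x))).
  - apply (analytic_mult (fun _ => - beta)); [apply analytic_const|].
    now apply (analytic_mult (fun x => cos (a * x))).
  - apply (analytic_mult (fun _ => a)); [apply analytic_const|].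
    apply (analytic_mult (fun x => cos (a * x))); trivial.
    apply (analytic_mult (fun x => / sin (a * x))); [|now apply analytic_mult].
    apply (analytic_inv (fun x => sin (a * x))); trivial. lra. }
destruct (analytic_antiderivative_exists 0 (PI / a) delta H hd aH) as (G & _ & dG & aG).
exists (fun p => G (polar_radius a O p) + - (nu / a * c) * polar_angle e1 e2 p).
set (Pc := fun r t => G (polar_radius a O (polar_chart a O e1 e2 r t))
  + - (nu / a * c) * polar_angle e1 e2 (polar_chart a O e1 e2 r t)).
assert (hPc : forall r t, 0 < r < PI / a -> 0 < t < 2 * PI ->
  Pc r t = G r + - (nu / a * c) * t).
{ intros r t hr ht. unfold Pc.
  rewrite polar_chart_point, polar_radius_point, polar_angle_point by (trivial; lra).
  reflexivity. }
cbv zeta. fold Pc.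
assert (hdom : forall r t,
  polar_domain a O e1 e2 (exterior_region a O e1 e2 delta tau) r t <->
  delta < r < PI / a /\ 0 < t < tau).
{ intros r t. apply polar_domain_exterior; trivial; lra. }
split.
- intros n.
  apply Ck2_on_iff with (fun r t => delta < r < PI / a /\ 0 < t < tau).
  { intros r t. symmetry. apply hdom. }
  apply Ck2_on_radial_plus_linear with G (- (nu / a * c)).
  + intros r t [hr ht]. apply hPc; lra.
  + intros m r hr. apply analytic_ex_derive_n, aG. lra.
- intros p r t hp hc.
  assert (h : delta < r < PI / a /\ 0 < t < tau) by (apply hdom; exists p; auto).
  destruct h as [hr ht].
  assert (hg := is_polar_metric_polar a delta O e1 e2 ha hO hb (proj1 hd)).
  assert (h1 : forall x, polar_interval a delta x -> is_derive Y x (Y1 x)).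
  { intros x hx. apply hY. unfold polar_interval in hx. lra. }
  assert (h2 : forall x, polar_interval a delta x -> is_derive Y1 x (Y2 x)).
  { intros x hx. apply hY. unfold polar_interval in hx. lra. }
  assert (hd0 : 0 <= delta) by lra.
  split; [|now apply (laminar_codiff1 a delta _ ha hd0 hg Y)].
  intros i. rewrite (laminar_momentum a delta _ ha hd0 hg Y Y1 Y2 h1 h2) by exact hr.
  assert (hs := sin_pos_radius a r ha ltac:(lra)).
  destruct i.
  + replace (partial Cr Pc r t) with (H r); [unfold H; field; lra|].
    symmetry. apply is_derive_unique.
    apply is_derive_ext_loc with (fun x => G x + - (nu / a * c) * t).
    * apply (locally_interval _ r delta (PI / a)); simpl; try apply hr.
      intros y b1 b2. symmetry. apply hPc; lra.
    * assert (dGr := dG r ltac:(lra)).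
      assert (E : Derive (fun x : R => G x) r = H r) by now apply is_derive_unique.
      auto_derive; [now exists (H r)|]. rewrite E. ring.
  + replace (partial Ct Pc r t) with (- (nu / a * c)).
    * fold (profile_operator a Y Y1 Y2 r).
      rewrite (proj2 (proj2 (proj2 (hY r ltac:(lra))))). ring.
    * symmetry. apply is_derive_unique.
      apply is_derive_ext_loc with (fun y => G r + - (nu / a * c) * y).
      -- apply (locally_interval _ t 0 tau); simpl; try apply ht.
         intros y b1 b2. symmetry. apply hPc; lra.
      -- auto_derive; trivial. ring.
Qed.

Lemma laminar_profile_exists (a nu beta : R) (O e1 e2 : R3)
    (delta tau alpha1 alpha2 : R) :
  0 < a -> sphere a O -> oriented_tangent_basis O e1 e2 ->
  0 < delta < PI / a -> 0 < tau < 2 * PI ->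
  exists Y, laminar_profile a nu beta O e1 e2 delta tau alpha1 alpha2 Y /\
    real_analytic_on (profile_interval a delta) Y.
Proof.
intros ha hO hb hd htau.
destruct (profile_solution_exists a delta alpha1 alpha2 ha hd)
  as (Y & Y1 & Y2 & i0 & i1 & i2 & hY).
assert (aY : forall x, profile_interval a delta x -> analytic_at Y x).
{ intros x [h1 h2]. apply hY. lra. }
exists Y. split; [|now apply analytic_at_real_analytic_on].
split; [|split; [|split; [|split]]]; trivial.
- intros n. eexists. now apply analytic_nth_derivative_on.
- eexists. split; [now apply analytic_nth_derivative_on|].
  rewrite <- i1. apply is_derive_unique. now apply hY.
- eexists. split; [now apply analytic_nth_derivative_on|].
  rewrite <- i2. apply is_derive_unique.
  (* The second derivative requires [Derive Y = Y1] on a full neighbourhood of [delta], available as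
     the solution lives on [(0, PI / a)]. *)
  apply is_derive_ext_loc with Y1; [|now apply hY].
  apply (locally_interval _ delta 0 (PI / a)); simpl; try apply hd.
  intros y h1 h2. symmetry. apply is_derive_unique. apply hY. lra.
- exact (pressure_exists a nu beta O e1 e2 delta tau _ Y Y1 Y2 ha hO hb hd htau hY).
Qed.

Theorem theorem1p6 (a nu beta : R) (O e1 e2 : R3) (delta tau : R) (K : R3 -> Prop) :
  0 < a -> 0 < nu -> 0 <= beta ->
  sphere a O ->
  oriented_tangent_basis O e1 e2 ->
  0 < delta < PI / a ->
  compact_set K ->
  (forall p, K p -> sphere a p /\ sphere_dist a p O <= delta) ->
  0 < tau < 2 * PI ->
  (forall p, arc a O e1 e2 delta tau p -> sphere_boundary a K p) ->
  (simply_connected (exterior_region a O e1 e2 delta tau) /\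
   (forall p, exterior_region a O e1 e2 delta tau p -> ~ K p) /\
   (forall p, arc a O e1 e2 delta tau p ->
      sphere_boundary a (exterior_region a O e1 e2 delta tau) p /\
      sphere_boundary a K p)) /\
  forall alpha1 alpha2 : R, 0 < alpha1 -> 0 < alpha2 ->
    exists Y : R -> R,
      laminar_profile a nu beta O e1 e2 delta tau alpha1 alpha2 Y /\
      (forall Z : R -> R,
         laminar_profile a nu beta O e1 e2 delta tau alpha1 alpha2 Z ->
         forall r, profile_interval a delta r -> Z r = Y r) /\
      real_analytic_on (profile_interval a delta) Y.
Proof.
intros ha hnu _ hO hb hd _ hK htau harc. split; [split; [|split]|].
- now apply exterior_region_simply_connected.
- intros p (_ & h & _) hp. assert (h' := proj2 (hK p hp)). lra.
- intros p hp. split; [|now apply harc]. now apply arc_boundary_exterior.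
- intros alpha1 alpha2 _ _.
  destruct (laminar_profile_exists a nu beta O e1 e2 delta tau alpha1 alpha2)
    as (Y & hY & aY); trivial.
  exists Y. split; [|split]; trivial.
  intros Z hZ. now apply (laminar_profile_unique a nu beta O e1 e2 delta tau alpha1 alpha2).
Qed.
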